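(* Let $X_n$ be the random variable giving the degree of symmetry $\mathrm{ds}(P)$ of a uniformly random grand Dyck path $P\in\mathcal{GD}_n$. Then the sequence $X_n$ has a Rayleigh limiting distribution; specifically, as $n\to\infty$, $$\frac{X_n}{\sqrt{n}}\stackrel{d}{\to}\mathcal R\left(\frac{1}{\sqrt{2}}\right),$$ which has density function $2xe^{-x^2}$ for $x\ge0$, and $$\mathbb{E} X_n=\frac{\sqrt{\pi n}}{2}+O(1),\qquad \mathbb{V} X_n=\left(1-\frac{\pi}{4}\right)n+O(\sqrt{n}),$$ $$\mathbb{P}(X_n=k)=\frac{2k}{n}e^{-k^2/n}+O((k+1)n^{-3/2})+O(n^{-1})$$ uniformly for all integers $k\ge0$.
   Context: For $n\ge 0$, $\mathcal{GD}_n$ is the set of grand Dyck paths of semilength $n$: lattice paths in the plane from $(0,0)$ to $(2n,0)$ with steps $U=(1,1)$ and $D=(1,-1)$ (no positivity constraint). For $P\in\mathcal{GD}_n$, let $\bar p_1,\dots,\bar p_{2n}$ be its steps from left to right, viewed as segments in the plane. The degree of symmetry $\mathrm{ds}(P)$ is the number of $i\in\{1,\dots,n\}$ such that $\bar p_i$ and $\bar p_{2n+1-i}$ are mirror images of each other under reflection along the vertical line $x=n$. $\mathcal R(\sigma)$ denotes the Rayleigh distribution with density $\frac{x}{\sigma^2}e^{-x^2/2\sigma^2}$ for $x\ge0$; $\stackrel{d}{\to}$ denotes convergence in distribution; $\mathbb{E}$ and $\mathbb{V}$ denote expected value and variance. *)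

(* Defs.v *)
From HB Require Import structures.
From mathcomp Require Import all_boot all_order all_algebra finmap.
From mathcomp Require Import all_classical all_reals all_analysis.
From mathcomp Require Import measurable_realfun ring.
Import Order.TTheory GRing.Theory Num.Theory.
Import numFieldNormedType.Exports.

Set Implicit Arguments.
Unset Strict Implicit.
Unset Printing Implicit Defensive.

Local Open Scope classical_set_scope.
Local Open Scope ring_scope.

(* A path is encoded by the sequence of its steps, [true] standing for
   U = (1, 1) and [false] for D = (1, -1). *)
Definition height (s : seq bool) (i : nat) : int :=
  \sum_(b <- take i s) (if b then 1 else -1).

Definition vertex (s : seq bool) (i : nat) : int * int := (i%:Z, height s i).

Record grand_dyck (n : nat) := GrandDyck {
  steps :> n.*2.-tuple bool;
  _ : vertex steps n.*2 == (n.*2%:Z, 0) }.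

HB.instance Definition _ n := [isSub for @steps n].
HB.instance Definition _ n := [Finite of grand_dyck n by <:].

(* The segments at stake are not vertical: each is given by its two endpoints,
   the left one first. *)
Definition segment : Type := ((int * int) * (int * int))%type.

(* Steps are indexed from 0: this is the (i+1)-th step of the path. *)
Definition step_segment (s : seq bool) (i : nat) : segment :=
  (vertex s i, vertex s i.+1).

Definition mirror_point (n : nat) (p : int * int) : int * int :=
  (n.*2%:Z - p.1, p.2).

(* The reflection along the line x = n exchanges left and right endpoints. *)
Definition mirror_segment (n : nat) (e : segment) : segment :=
  (mirror_point n e.2, mirror_point n e.1).

(* With 0-based indices, the steps i and 2n+1-i become i and 2n-(i+1). *)
Definition degree_of_symmetry (n : nat) (P : grand_dyck n) : nat :=
  #|[set i : 'I_n | step_segment P (n.*2 - i.+1)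
                    == mirror_segment n (step_segment P i)]%SET|.

Lemma zigzag_subproof (n : nat) :
  let s := [tuple of nseq n true ++ nseq n false] in
  vertex (tcast (addnn n) s) n.*2 == (n.*2%:Z, 0).
Proof.
rewrite /= xpair_eqE eqxx /= /height take_oversize ?size_tuple// val_tcast /=.
by rewrite big_cat /= !big_nseq !iter_addr_0 mulNrn subrr.
Qed.

Definition zigzag (n : nat) : grand_dyck n := GrandDyck (zigzag_subproof n).

HB.instance Definition _ n := isPointed.Build (grand_dyck n) (zigzag n).
HB.instance Definition _ n := @isMeasurable.Build default_measure_display
  (grand_dyck n) discrete_measurable discrete_measurable0
  discrete_measurableC discrete_measurableU.

Lemma card_grand_dyck_gt0 n : (0 < #|{: grand_dyck n}|)%N.
Proof. by apply/card_gt0P; exists (zigzag n). Qed.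

Section uniform.
Context (R : realType) (n : nat).

Definition gd_uniform : set (grand_dyck n) -> \bar R :=
  mscale (#|{: grand_dyck n}|%:R^-1)%:nng (@counting (grand_dyck n) R).

HB.instance Definition _ := Measure.on gd_uniform.

Lemma gd_uniformE (A : {set grand_dyck n}) :
  gd_uniform [set` A] = (#|A|%:R / #|{: grand_dyck n}|%:R)%:E.
Proof.
rewrite /gd_uniform /mscale /= /counting asboolT; last exact: finite_finset.
rewrite -EFinM mulrC; congr (_ %:R / _)%:E.
rewrite [fset_set _](_ : _ = [fset x in A]%fset); last first.
  apply/fsetP => x; rewrite in_fset_set; last exact: finite_finset.
  by rewrite !inE; apply/idP/idP; rewrite ?inE.
by rewrite card_imfset//= -cardE.
Qed.

Let gd_uniform_setT : gd_uniform [set: _] = 1%:E.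
Proof.
have -> : [set: grand_dyck n] = [set` [set: grand_dyck n]%SET].
  by apply/seteqP; split=> x //=; rewrite inE.
by rewrite gd_uniformE cardsT divff// pnatr_eq0 -lt0n card_grand_dyck_gt0.
Qed.

HB.instance Definition _ :=
  @Measure_isProbability.Build _ _ R gd_uniform gd_uniform_setT.

Definition sym_rv (P : grand_dyck n) : R := (degree_of_symmetry P)%:R.

HB.instance Definition _ := @isMeasurableFun.Build _ _ (grand_dyck n) R
  sym_rv (fun _ _ _ => I).

End uniform.
Arguments gd_uniform R n : clear implicits.
Arguments sym_rv R n : clear implicits.

Section rayleigh_pdf.
Context {R : realType}.
Implicit Types (sigma x : R).

Definition rayleigh_pdf sigma : R -> R :=
  (fun x => x / sigma ^+ 2 * expR (- x ^+ 2 / (2 * sigma ^+ 2)))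
    \_ `[0, +oo[.

Lemma rayleigh_pdf_ge0 sigma x : 0 <= rayleigh_pdf sigma x.
Proof.
rewrite /rayleigh_pdf; apply: restrict_ge0 => {}x /=.
rewrite in_itv/= andbT => x0.
by rewrite mulr_ge0 ?expR_ge0// divr_ge0// sqr_ge0.
Qed.

Lemma rayleigh_pdfE sigma x : 0 <= x -> rayleigh_pdf sigma x =
  x / sigma ^+ 2 * expR (- x ^+ 2 / (2 * sigma ^+ 2)).
Proof. by move=> x0; rewrite /rayleigh_pdf patchE ifT// inE/= in_itv/= x0. Qed.

Let cexp sigma :
  continuous (fun x : R => expR (- x ^+ 2 / (2 * sigma ^+ 2))).
Proof.
move=> x; apply: continuous_comp; last exact: continuous_expR.
apply: cvgM; last exact: cvg_cst.
by apply: cvgN; exact: exprn_continuous.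
Qed.

Let cpdf sigma : continuous
  (fun x : R => x / sigma ^+ 2 * expR (- x ^+ 2 / (2 * sigma ^+ 2))).
Proof.
move=> x; apply: cvgM; last exact: cexp.
by apply: cvgM; [exact: cvg_id|exact: cvg_cst].
Qed.

Lemma measurable_rayleigh_pdf sigma :
  measurable_fun [set: R] (rayleigh_pdf sigma).
Proof.
apply/measurable_restrict => //; apply: measurable_funTS.
by apply: continuous_measurable_fun; exact: cpdf.
Qed.

Lemma integral_rayleigh_pdf sigma : 0 < sigma ->
  (\int[lebesgue_measure]_x (rayleigh_pdf sigma x)%:E = 1)%E.
Proof.
move=> s0.
transitivity (\int[lebesgue_measure]_(x in `[0%R, +oo[)
    (x / sigma ^+ 2 * expR (- x ^+ 2 / (2 * sigma ^+ 2)))%:E)%E.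
  rewrite [RHS]integral_mkcond; apply: eq_integral => x _.
  by rewrite /rayleigh_pdf !patchE; case: ifP.
pose c := 2 * sigma ^+ 2.
have c0 : 0 < c by rewrite mulr_gt0// exprn_gt0.
pose F x : R := - expR (- x ^+ 2 / (2 * sigma ^+ 2)).
have dF x : is_derive x 1 F
    (x / sigma ^+ 2 * expR (- x ^+ 2 / (2 * sigma ^+ 2))).
  have dg : is_derive x 1 (- (c^-1 *: (@GRing.exp R ^~ 2)))
      (- (c^-1 *: (x *+ 2))).
    apply: is_deriveN; apply: is_deriveZ.
    by apply: is_derive_eq; rewrite /GRing.scale/= !mulr1.
  have -> : F = - (expR \o - (c^-1 *: (@GRing.exp R ^~ 2))).
    by apply/funext => y; rewrite /F !fctE /= mulNr mulrC.
  apply: is_derive_eq.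
  rewrite !fctE /c /GRing.scale/=.
  rewrite mulrN opprK mulrC [in RHS]mulNr [in RHS](mulrC (x ^+ 2)).
  by congr (_ * _); rewrite -mulr_natl; field; rewrite gt_eqF.
rewrite (@ge0_continuous_FTC2y _ _ F 0 0).
- by rewrite /F expr0n/= oppr0 mul0r expR0 -EFinB opprK add0r.
- by move=> x x0; rewrite mulr_ge0 ?expR_ge0// divr_ge0// sqr_ge0.
- by apply: continuous_subspaceT; exact: cpdf.
- rewrite -oppr0; apply: cvgN.
  rewrite (_ : (fun x => _) = (fun x : R => expR (- x)) \o
      (fun y : R => c^-1 * y) \o (fun x : R => x ^+ 2)); last first.
    by apply/funext => y /=; rewrite mulNr mulrC.
  apply: cvg_comp; first exact: cvgr_expr2.
  apply: (@cvg_comp _ _ _ _ _ _ (pinfty_nbhs R)); last exact: cvgr_expR.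
  by apply: gt0_cvgMry; rewrite ?invr_gt0//; exact: cvg_id.
- by move=> x _; apply: ex_derive.
- by apply: cvgN; apply/cvg_at_right_filter; exact: cexp.
- by move=> x _; rewrite derive1E; exact: derive_val.
Qed.

End rayleigh_pdf.

Section rayleigh_prob.
Context {R : realType} (sigma : {posnum R}).

Definition rayleigh_prob (A : set R) : \bar R :=
  (\int[lebesgue_measure]_(x in A) (rayleigh_pdf sigma%:num x)%:E)%E.

Let rayleigh0 : rayleigh_prob set0 = 0%E.
Proof. by rewrite /rayleigh_prob integral_set0. Qed.

Let rayleigh_ge0 A : (0 <= rayleigh_prob A)%E.
Proof. by apply: integral_ge0 => x _; rewrite lee_fin rayleigh_pdf_ge0. Qed.

Let rayleigh_sigma_additive : semi_sigma_additive rayleigh_prob.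
Proof.
move=> /= F mF tF mUF; rewrite /rayleigh_prob; apply: cvg_toP.
  apply: ereal_nondecreasing_is_cvgn => m n mn.
  apply: lee_sum_nneg_natr => // k _ _; apply: integral_ge0 => /= x Fkx.
  by rewrite lee_fin rayleigh_pdf_ge0.
rewrite ge0_integral_bigcup//=.
- apply/measurable_funTS/measurableT_comp => //.
  exact: measurable_rayleigh_pdf.
- by move=> x _; rewrite lee_fin rayleigh_pdf_ge0.
Qed.

HB.instance Definition _ := isMeasure.Build _ _ _
  rayleigh_prob rayleigh0 rayleigh_ge0 rayleigh_sigma_additive.

Let rayleigh_setT : rayleigh_prob [set: R] = 1%E.
Proof. exact: integral_rayleigh_pdf. Qed.

HB.instance Definition _ :=
  @Measure_isProbability.Build _ _ R rayleigh_prob rayleigh_setT.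

End rayleigh_prob.

(* Convergence of the cumulative distribution functions at every point where
   the limiting one is continuous. *)
Definition cvg_in_distribution (R : realType)
    (nu : nat -> probability R R)
    (mu : probability R R) : Prop :=
  forall x : R, {for x, continuous (fun y : R => mu `]-oo, y]%classic)} ->
    nu n `]-oo, x]%classic @[n --> \oo] --> mu `]-oo, x]%classic.

(* Main.v *)
(* Write D_i for the difference of the heights of the path at i and at 2n - i.
   Then D / 2 is a bridge of length n with steps +1, -1 (weight 1) and 0
   (weight 2), and the degree of symmetry counts its flat steps at height 0.
   With z = w / (1 + w)^2, paths with k such steps have generating function
   (2z)^k / (1 - 2zw)^(k+1): between two consecutive flat steps at 0 there is a
   sequence of excursions, each counted by 2zw.  Expanding in the number j of
   excursions gives P(X_n = k) as a negative binomial average over j (of mean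
   k + 1) of the ballot numbers [z^N] w^j = (j / N) C(2N, N + j), N = n - k - j.
   These are close to a smooth function of j, so that a second order Taylor
   expansion at j = k yields the local limit.  The tail k > n / 8 and the moments
   come from the exact values of the first two factorial moments, and the
   constant pi from Wallis' bounds on central binomial coefficients.  Summing
   the local limit gives the convergence in distribution. *)

Require Import Defs.
From mathcomp Require Import all_boot all_order all_algebra.
From mathcomp Require Import all_classical all_reals all_analysis.
From mathcomp Require Import measurable_realfun ring lra zify.
Import Order.TTheory GRing.Theory Num.Theory.
Import numFieldNormedType.Exports.

Set Implicit Arguments.
Unset Strict Implicit.
Unset Printing Implicit Defensive.

Local Open Scope classical_set_scope.
Local Open Scope ring_scope.

(** * Lazy walks *)

Section LazyWalks.
Context {R : realFieldType}.
Implicit Types (phi psi : nat -> R) (n h k : nat).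

(* Sum of phi (number of flat steps at height 0) over the weighted walks of
   length n from height h to 0.  The law is symmetric, so that only the absolute
   value of the height is recorded: hence the factor 2 in front of the upward
   step from 0, while the other 2 is the weight of a flat step. *)
Fixpoint walk_sum phi n h {struct n} : R :=
  match n, h with
  | 0, 0 => phi 0%N
  | 0, _.+1 => 0
  | n'.+1, 0 => 2 * walk_sum phi n' 1 + 2 * walk_sum (phi \o succn) n' 0
  | n'.+1, h'.+1 =>
      walk_sum phi n' h' + 2 * walk_sum phi n' h'.+1 + walk_sum phi n' h'.+2
  end.

Lemma walk_sumS0 phi n : walk_sum phi n.+1 0 =
  2 * walk_sum phi n 1 + 2 * walk_sum (phi \o succn) n 0.
Proof. by []. Qed.

Lemma walk_sumSS phi n h : walk_sum phi n.+1 h.+1 =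
  walk_sum phi n h + 2 * walk_sum phi n h.+1 + walk_sum phi n h.+2.
Proof. by []. Qed.

Lemma eq_walk_sum phi psi n h : phi =1 psi -> walk_sum phi n h = walk_sum psi n h.
Proof.
elim: n phi psi h => [|n IH] phi psi [|h] e //=.
  by rewrite (IH _ _ _ e) (IH (phi \o succn) (psi \o succn))// => k /=.
by rewrite !(IH _ _ _ e).
Qed.

Lemma walk_sumD phi psi n h :
  walk_sum (fun k => phi k + psi k) n h = walk_sum phi n h + walk_sum psi n h.
Proof.
elim: n phi psi h => [|n IH] phi psi [|h] //=; first by rewrite addr0.
  rewrite IH (IH (phi \o succn) (psi \o succn)); ring.
by rewrite !IH; ring.
Qed.

Lemma walk_sumZ c phi n h :
  walk_sum (fun k => c * phi k) n h = c * walk_sum phi n h.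
Proof.
elim: n phi h => [|n IH] phi [|h] //=; first by rewrite mulr0.
  rewrite IH (IH (phi \o succn)); ring.
by rewrite !IH; ring.
Qed.

Lemma walk_sum_ge0 phi n h : (forall k, 0 <= phi k) -> 0 <= walk_sum phi n h.
Proof.
elim: n phi h => [|n IH] phi [|h] p //=.
  by rewrite addr_ge0// mulr_ge0// IH// => k /=.
by rewrite !addr_ge0// ?mulr_ge0// IH.
Qed.

Lemma ler_walk_sum phi psi n h :
  (forall k, phi k <= psi k) -> walk_sum phi n h <= walk_sum psi n h.
Proof.
move=> le; rewrite -subr_ge0 -mulN1r -walk_sumZ -walk_sumD.
by apply: walk_sum_ge0 => k; rewrite mulN1r subr_ge0.
Qed.

Lemma binDS n h : 'C(n.+1.*2, n.+1 + h.+1) =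
  ('C(n.*2, n + h) + 2 * 'C(n.*2, n + h.+1) + 'C(n.*2, n + h.+2))%N.
Proof. by rewrite doubleS !addnS addSn !binS; lia. Qed.

Lemma binD0 n : 'C(n.+1.*2, n.+1) = (2 * 'C(n.*2, n.+1) + 2 * 'C(n.*2, n))%N.
Proof.
have e : 'C(n.*2.+1, n) = 'C(n.*2.+1, n.+1).
  by rewrite -[RHS]bin_sub ?subSS; [congr 'C(_, _); lia|lia].
by rewrite doubleS binS e binS; lia.
Qed.

(** The weights 1, 2, 1 are those of two half steps up or down, so for constant [phi] the lazy walks
    of length [n] amount to simple walks of length [2n]. *)
Lemma walk_sum1 n h : walk_sum (fun=> 1) n h = 'C(n.*2, n + h)%:R.
Proof.
elim: n h => [|n IH] [|h] //=.
  rewrite (eq_walk_sum (psi := fun=> 1))// !IH addn0 addn1 addn0.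
  by rewrite binD0 natrD !natrM.
by rewrite binDS !IH 2!natrD natrM !addnS.
Qed.

(* Generating functions are multiples of w^h: the two sides carry the factors
   1 - w and 1 + w, whose quotient is sqrt (1 - 4 z). *)
Lemma walk_sum_diff phi psi n h : phi 0%N = 0 ->
    (forall k, phi k.+1 = phi k + psi k) ->
  walk_sum phi n.+1 h - walk_sum phi n.+1 h.+1 =
  2 * (walk_sum psi n h + walk_sum psi n h.+1).
Proof.
move=> phi0 phiS.
have phiSE m i : walk_sum (phi \o succn) m i = walk_sum phi m i + walk_sum psi m i.
  by rewrite -walk_sumD; exact: eq_walk_sum.
elim: n h => [|n IH] [|h].
- by rewrite /= phiS phi0; ring.
- by rewrite /= phi0; case: h => [|h]; ring.
- rewrite [walk_sum phi n.+2 0]walk_sumS0 phiSE [walk_sum phi n.+2 1]walk_sumSS.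
  rewrite [walk_sum psi n.+1 1]walk_sumSS.
  have := IH 0%N; have := IH 1%N; lra.
- rewrite [walk_sum phi n.+2 h.+1]walk_sumSS [walk_sum phi n.+2 h.+2]walk_sumSS.
  rewrite [walk_sum psi n.+1 h.+1]walk_sumSS [walk_sum psi n.+1 h.+2]walk_sumSS.
  have := IH h; have := IH h.+1; have := IH h.+2; lra.
Qed.

(** [walk_sum_diff] with [psi = 1] eliminates the value at height 1 from the recursion at height 0,
    which becomes multiplication by 4. *)
Lemma walk_sum_id n : walk_sum (fun k => k%:R) n.+1 0 = 2 * 4 ^+ n.
Proof.
have S k : k.+1%:R = k%:R + 1 :> R by rewrite -natr1.
have SE m i : walk_sum ((fun k => k%:R) \o succn) m i =
    walk_sum (fun k => k%:R) m i + walk_sum (fun=> 1) m i.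
  by rewrite -walk_sumD; exact: eq_walk_sum.
elim: n => [|n IH]; first by rewrite /= !(mulr0, add0r) expr0.
have := walk_sum_diff n 0 erefl S.
have := walk_sumS0 (fun=> 1) n.
rewrite [walk_sum _ n.+2 0]walk_sumS0 SE exprS mulrCA -IH.
rewrite (eq_walk_sum (phi := (fun=> 1) \o succn) (psi := fun=> 1))//.
lra.
Qed.

(** The first and second differences of [k (k - 1)] are [2 k] and 2, so [walk_sum_diff] again closes
    the recursion at height 0, now with a central binomial as source term. The factor [2 n - 1]
    clears the denominator of the closed form. *)
Lemma walk_sum_falling n :
  walk_sum (fun k => k%:R * (k%:R - 1)) n 0 * (2 * n%:R - 1) =
  2 * n%:R * (n%:R - 1) * 'C(n.*2, n)%:R.
Proof.
pose f k : R := k%:R * (k%:R - 1); pose g k : R := 2 * k%:R.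
have S k : f k.+1 = f k + g k by rewrite /f /g -natr1; ring.
have gS k : g k.+1 = g k + 2 by rewrite /g -natr1; ring.
have f0 : f 0%N = 0 by rewrite /f mul0r.
have g0 : g 0%N = 0 by rewrite /g mulr0.
have SE m i : walk_sum (f \o succn) m i = walk_sum f m i + walk_sum g m i.
  by rewrite -walk_sumD; exact: eq_walk_sum.
have gSE m i : walk_sum (g \o succn) m i = walk_sum g m i + 2 * walk_sum (fun=> 1) m i.
  by rewrite -walk_sumZ -walk_sumD; apply: eq_walk_sum => k /=; rewrite gS mulr1.
have rec m : walk_sum f m.+2 0 = 4 * walk_sum f m.+1 0 + 8 * 'C(m.*2, m)%:R.
  have := walk_sum_diff m 0 f0 S; have := walk_sumS0 g m.
  rewrite [walk_sum _ m.+2 0]walk_sumS0 SE gSE walk_sum1 addn0; lra.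
have cat m : m.+1%:R * 'C(m.+1.*2, m.+1)%:R = 2 * (2 * m%:R + 1) * 'C(m.*2, m)%:R :> R.
  have := mul_bin_left m.*2 m; have := binD0 m.
  rewrite (_ : m.*2 - m = m)%N; last lia.
  move/(congr1 (fun x => x%:R : R)); rewrite natrD !natrM => e1.
  move/(congr1 (fun x => x%:R : R)); rewrite !natrM => e2.
  rewrite e1 mulrDr [X in X + _]mulrCA e2 -natr1; ring.
rewrite -[walk_sum _ n 0]/(walk_sum f n 0).
elim: n => [|[_|m IH]]; first by rewrite /= f0; ring.
  by rewrite walk_sumS0 SE /= f0 g0; ring.
rewrite rec; set w := walk_sum _ _ _ in IH *.
have := cat m; have := cat m.+1; set x := 'C(m.*2, m)%:R.
set y := 'C(m.+1.*2, m.+1)%:R in IH *; set z := 'C(m.+2.*2, m.+2)%:R.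
have mS : m.+1%:R = m%:R + 1 :> R by rewrite natr1.
have mSS : m.+2%:R = m%:R + 1 + 1 :> R by rewrite !natr1.
rewrite ?(mSS, mS) in IH * => e2 e1.
have m0 : 0 <= m%:R :> R by [].
have ew : w = 4 * m%:R * x.
  apply: (@mulIf _ (2 * (m%:R + 1) - 1)); first by apply/eqP; lra.
  rewrite IH; transitivity (2 * m%:R * ((m%:R + 1) * y)); first ring.
  by rewrite e1; ring.
transitivity (4 * (2 * m%:R + 3) * ((m%:R + 1) * y)); first by rewrite ew e1; ring.
transitivity (2 * (m%:R + 1) * ((m%:R + 1 + 1) * z)); last ring.
by rewrite e2; ring.
Qed.
End LazyWalks.

(** * First passages to 0 and walks with a prescribed number of flat steps *)

Section FirstHit.
Context {R : realFieldType}.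
Implicit Types (N a n h k m : nat).

(* Weight of the walks of length N from height a that reach 0 at their last step
   only: the coefficient [z^N] w^a. *)
Fixpoint first_hit N a {struct N} : R :=
  match N, a with
  | 0, 0 => 1
  | 0, _.+1 => 0
  | _.+1, 0 => 0
  | N'.+1, a'.+1 =>
      first_hit N' a' + 2 * first_hit N' a'.+1 + first_hit N' a'.+2
  end.

Lemma first_hitSS N a : first_hit N.+1 a.+1 =
  first_hit N a + 2 * first_hit N a.+1 + first_hit N a.+2.
Proof. by []. Qed.

Lemma first_hit_ge0 N a : 0 <= first_hit N a.
Proof.
by elim: N a => [|N IH] [|a] //=; rewrite !addr_ge0// ?mulr_ge0// IH.
Qed.

Lemma first_hit_le N a : first_hit N a <= 4 ^+ N.
Proof.
elim: N a => [|N IH] [|a] //; rewrite exprS.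
  by rewrite mulr_ge0 ?exprn_ge0.
rewrite first_hitSS; have := IH a; have := IH a.+1; have := IH a.+2; lra.
Qed.

(** The ballot formula for first passages, checked against the one-step recursion. *)
Lemma first_hit_bin N a :
  N%:R * first_hit N a = a%:R * 'C(N.*2, N + a)%:R.
Proof.
elim: N a => [|N IH] a; first by case: a => [|a] /=; rewrite ?mul0r ?mulr0.
case: a => [|a]; first by rewrite /= mul0r mulr0.
(* The induction hypothesis carries the factor [N] and is empty for [N = 0], so length 1 is treated
   directly. *)
case: N IH => [_|M IH].
  case: a => [|a]; first by rewrite first_hitSS /= !(mulr0, addr0) binn.
  rewrite first_hitSS bin_small ?mulr0; last lia.
  by rewrite /= !(mulr0, addr0).
set N := M.+1 in IH *.
have N0 : N%:R != 0 :> R by rewrite pnatr_eq0.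
apply: (mulfI N0); rewrite first_hitSS binDS 2!natrD natrM.
have eB b : (N%:R - b%:R) * 'C(N.*2, N + b)%:R =
    (N%:R + b%:R + 1) * 'C(N.*2, N + b.+1)%:R :> R.
  have [bN|Nb] := leqP b N; last by rewrite !bin_small ?mulr0 //; lia.
  have := mul_bin_left N.*2 (N + b).
  rewrite (_ : N.*2 - (N + b) = N - b)%N; last lia.
  move/(congr1 (fun x => x%:R : R)); rewrite !natrM natrB// => <-.
  by rewrite addnS -natr1 natrD.
have e0 := eB a; have e1 := eB a.+1.
have := IH a; have := IH a.+1; have := IH a.+2.
set h0 := first_hit N a; set h1 := first_hit N a.+1; set h2 := first_hit N a.+2.
rewrite -[a.+2%:R]natr1 -[N.+1%:R]natr1 -[a.+1%:R]natr1 in e1 *.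
set x := 'C(_, N + a)%:R in e0 *; set y := 'C(_, N + a.+1)%:R in e0 e1 *.
set z := 'C(_, N + a.+2)%:R in e1 *.
move=> E2 E1 E0.
transitivity ((N%:R + 1) * (N%:R * h0 + 2 * (N%:R * h1) + N%:R * h2)); first ring.
rewrite E0 E1 E2; lra.
Qed.

(* Here m is the number of returns to 0, each weighted by 2: k of them are flat
   steps and the others end an excursion; the m - k excursions and the initial
   descent have been glued into one first passage. The truncation in m - k is
   harmless since 'C(m, k) vanishes for m < k. *)
Lemma walk_sum_pred1 k n h : walk_sum (fun i => (i == k)%:R) n h =
  \sum_(m < n.+1) 'C(m, k)%:R * 2 ^+ m * first_hit (n - m) (m - k + h).
Proof.
elim: n k h => [|n IH] k h.
  rewrite big_ord1 expr0 mulr1; case: k h => [|k] [|h] /=;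
    by rewrite ?mulr0 ?mulr1 ?mul0r.
case: h => [|h].
  rewrite walk_sumS0 IH [RHS]big_ord_recl.
  rewrite [X in _ = X + _](_ : _ = 0); last by rewrite /= mulr0.
  rewrite add0r; case: k => [|k].
    rewrite (eq_walk_sum (psi := fun=> 0 * 0)) => [|k]; last by rewrite mulr0.
    rewrite walk_sumZ mul0r mulr0 addr0 mulr_sumr; apply: eq_bigr => i _.
    by rewrite !bin0 !subn0 !addn0 addn1 subSS exprS; ring.
  (* Pascal's rule on ['C(i.+1, k.+1)] mirrors the first step: a flat one uses up one of the [k.+1],
     a step away from 0 opens an excursion. *)
  rewrite (eq_walk_sum (psi := fun i => (i == k)%:R))// IH !mulr_sumr -big_split/=.
  apply: eq_bigr => i _; rewrite /bump/= add1n !subSS addn0 exprS binS natrD.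
  have [ki|ik] := ltnP k i; last first.
    have -> : 'C(i, k.+1) = 0%N by rewrite bin_small.
    by rewrite !mul0r; ring.
  by rewrite (_ : i - k.+1 + 1 = i - k)%N; [ring|lia].
rewrite walk_sumSS !IH [RHS]big_ord_recr /= subnn addnS [first_hit 0 _]/= mulr0 addr0.
rewrite mulr_sumr -!big_split/=; apply: eq_bigr => i _.
by rewrite subSn 1?leq_ord// addnS first_hitSS !addnS; ring.
Qed.
End FirstHit.

(** * From grand Dyck paths to lazy walks *)

Section PairedSteps.
Implicit Types (p : bool * bool) (q : seq (bool * bool)) (h : int).

Definition rise (b : bool) : int := if b then 1 else -1.

(** Half the change of the difference of heights when both ends move one step inwards. The value 0
    comes from two of the four pairs, whence the weight 2 of a flat step. *)
Definition half_drift p : int := (p.1 + p.2)%N%:Z - 1.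

Definition flat_step h p : bool := (h == 0) && (h + half_drift p == 0).

Fixpoint flat_count h q : nat :=
  if q is p :: q' then
    addn (flat_step h p) (flat_count (h + half_drift p) q')
  else 0%N.

Lemma flat_countE h q : flat_count h q =
  (\sum_(i < size q) ((h + \sum_(p <- take i q) half_drift p == 0)%R &&
                      (h + \sum_(p <- take i.+1 q) half_drift p == 0)%R))%N.
Proof.
elim: q h => [|p q IH] h /=; first by rewrite big_ord0.
rewrite big_ord_recl /= take0 big_nil addr0 big_seq1 IH; congr (_ + _)%N.
by apply: eq_bigr => i _; rewrite /= !big_cons !addrA.
Qed.

(** Both sides are split along the first pair. A walk and its reflection in height 0 have the same
    flat steps at 0, so only the absolute value of [h] matters. *)
Lemma sum_flat_count (R : realFieldType) (phi : nat -> R) n h :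
  \sum_(q : n.-tuple (bool * bool) | h + \sum_(p <- q) half_drift p == 0)
    phi (flat_count h q) = walk_sum phi n `|h|%N.
Proof.
elim: n phi h => [|n IH] phi h.
  rewrite (eq_bigl (fun=> h == 0)); last first.
    by move=> q; rewrite tuple0 big_nil addr0.
  case: h => [[|h]|h] /=; [|by rewrite big_pred0..].
  by rewrite (big_pred1 [tuple]) // => q; rewrite [q]tuple0; apply/esym/eqP.
pose cons2 (x : (bool * bool) * n.-tuple (bool * bool)) := [tuple of x.1 :: x.2].
rewrite (reindex cons2); last first.
  exists (fun q : n.+1.-tuple _ => (thead q, [tuple of behead q])) => [[p q] _|q _].
    by rewrite /cons2 /= theadE; congr pair; apply: val_inj.
  by rewrite /cons2 /= -tuple_eta.
rewrite -(pair_big_dep xpredT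
  (fun p (q : n.-tuple _) => h + \sum_(i <- p :: q : seq _) half_drift i == 0)
  (fun p (q : n.-tuple _) => phi (flat_count h (p :: q))))/=.
have E p : \sum_(q : n.-tuple _ | h + \sum_(i <- p :: q : seq _) half_drift i == 0)
    phi (addn (flat_step h p) (flat_count (h + half_drift p) q))
   = walk_sum (fun k => phi (flat_step h p + k)%N) n
       (absz (h + half_drift p)).
  by rewrite -IH; apply: eq_bigl => q; rewrite big_cons addrA.
rewrite (eq_bigr _ (fun p _ => E p)).
rewrite -(pair_big xpredT xpredT (fun a b => walk_sum (fun k => phi
  (flat_step h (a, b) + k)%N) n (absz (h + half_drift (a, b)))))/=.
rewrite !big_bool /flat_step /half_drift !addn0 !addn1.
rewrite (_ : h + (2%:Z - 1) = h + 1); last lia.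
rewrite (_ : h + (1%:Z - 1) = h); last lia.
rewrite (_ : h + (0%:Z - 1) = h - 1); last lia.
case: h {E} => [[|h]|h].
- by change (walk_sum phi n 1 + walk_sum (phi \o succn) n 0 +
    (walk_sum (phi \o succn) n 0 + walk_sum phi n 1) = walk_sum phi n.+1 0);
    rewrite walk_sumS0; ring.
- rewrite (_ : absz (h.+1%:Z + 1) = h.+2); last lia.
  by rewrite (_ : absz (h.+1%:Z - 1) = h); [rewrite /=; ring|lia].
- rewrite (_ : absz (Negz h + 1) = h); last lia.
  by rewrite (_ : absz (Negz h - 1) = h.+2); [rewrite /=; ring|lia].
Qed.

(** The path is folded at its middle, so that each step sits with its candidate mirror image. *)
Definition pair_steps n (s : seq bool) : seq (bool * bool) :=
  zip (take n s) (rev (drop n s)).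

Definition unpair_steps q : seq bool := unzip1 q ++ rev (unzip2 q).

Lemma size_pair_steps n (s : n.*2.-tuple bool) : size (pair_steps n s) == n.
Proof. by rewrite size_zip size_takel ?size_rev ?size_drop size_tuple; lia. Qed.

Lemma size_unpair_steps n (q : n.-tuple (bool * bool)) :
  size (unpair_steps q) == n.*2.
Proof. by rewrite size_cat size_rev !size_map size_tuple addnn. Qed.

Lemma pair_stepsK n (s : n.*2.-tuple bool) : unpair_steps (pair_steps n s) = s.
Proof.
have e : size (take n s) = size (rev (drop n s)).
  by rewrite size_takel ?size_rev ?size_drop size_tuple; lia.
by rewrite /unpair_steps /pair_steps unzip1_zip ?e// unzip2_zip ?e// revK cat_take_drop.
Qed.

Lemma unpair_stepsK q : pair_steps (size q) (unpair_steps q) = q.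
Proof.
rewrite /unpair_steps /pair_steps take_size_cat ?size_map//.
by rewrite drop_size_cat ?size_map// revK zip_unzip.
Qed.

Lemma height_unpair_left q i : (i <= size q)%N ->
  height (unpair_steps q) i = \sum_(p <- take i q) rise p.1.
Proof.
move=> iq; rewrite /height /unpair_steps takel_cat ?size_map//.
by rewrite -map_take big_map.
Qed.

Lemma height_unpair_right q i : (i <= size q)%N ->
  height (unpair_steps q) ((size q).*2 - i) =
  \sum_(p <- q) rise p.1 +
  \sum_(p <- drop i q) rise p.2.
Proof.
move=> iq; rewrite /height /unpair_steps take_cat size_map ifF; last lia.
rewrite big_cat /= big_map take_rev size_map; congr (_ + _).
rewrite (perm_big _ (permEl (perm_rev _))) -map_drop big_map.
by congr (\sum_(p <- drop _ q) _); lia.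
Qed.

Lemma half_driftE p :
  rise p.1 + rise p.2 = half_drift p *+ 2.
Proof. by case: p => [[] []]. Qed.

Lemma height_unpair q :
  height (unpair_steps q) (size q).*2 = (\sum_(p <- q) half_drift p) *+ 2.
Proof.
rewrite -[(size q).*2]subn0 height_unpair_right// drop0 -big_split/= -sumrMnl.
by apply: eq_bigr => p _; exact: half_driftE.
Qed.

(** As the path ends at height 0, its height [i] steps before the end is minus the sum of the last
    [i] rises; the difference of the two heights is therefore twice the partial sum of half
    drifts. *)
Lemma height_unpair_eq q i : \sum_(p <- q) half_drift p = 0 -> (i <= size q)%N ->
  (height (unpair_steps q) i == height (unpair_steps q) ((size q).*2 - i)) =
  (\sum_(p <- take i q) half_drift p == 0).
Proof.
move=> q0 iq; rewrite height_unpair_left// height_unpair_right//.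
have : 0 = (\sum_(p <- q) rise p.1 +
    (\sum_(p <- take i q) rise p.2 +
     \sum_(p <- drop i q) rise p.2))%R :> int.
  have := height_unpair_right (leq0n (size q)).
  by rewrite -big_cat cat_take_drop subn0 height_unpair q0 mul0rn drop0.
move=> e.
rewrite (_ : (_ == 0) = ((\sum_(p <- take i q) half_drift p) *+ 2 == 0)); last first.
  by rewrite mulrn_eq0.
rewrite -sumrMnl -(eq_bigr _ (fun p _ => half_driftE p)) big_split/=.
move: e; set a := bigop.body _ (take i q) _; set b := bigop.body _ (take i q) _.
set c := bigop.body _ q _; set d := bigop.body _ (drop i q) _ => e.
by apply/eqP/eqP; lia.
Qed.

(** The abscissas always match, so being mirror images only asks for equal heights at both ends of
    the step. *)
Lemma symmetric_step q i : \sum_(p <- q) half_drift p = 0 -> (i < size q)%N ->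
  (step_segment (unpair_steps q) ((size q).*2 - i.+1) ==
   mirror_segment (size q) (step_segment (unpair_steps q) i)) =
  (\sum_(p <- take i q) half_drift p == 0) &&
  (\sum_(p <- take i.+1 q) half_drift p == 0).
Proof.
move=> q0 iq; have e1 := height_unpair_eq q0 iq.
have e0 := height_unpair_eq q0 (ltnW iq).
rewrite -e0 -e1 /step_segment /mirror_segment /mirror_point /vertex /=.
rewrite !xpair_eqE (_ : ((size q).*2 - i.+1).+1 = (size q).*2 - i)%N; last lia.
rewrite -!subzn ?eqxx/=; [|lia..].
by rewrite eq_sym andbC eq_sym.
Qed.

Lemma flat_count_unpair n (P : grand_dyck n) (q : n.-tuple (bool * bool)) :
  unpair_steps q = P -> \sum_(p <- q) half_drift p = 0 ->
  degree_of_symmetry P = flat_count 0 q.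
Proof.
move=> eP q0; rewrite flat_countE /degree_of_symmetry -sum1_card big_mkcond.
rewrite size_tuple; apply: eq_bigr => i _; rewrite inE -eP !add0r.
by have := @symmetric_step q i q0; rewrite size_tuple => ->.
Qed.

(** Folding is a bijection onto the sequences of pairs with total half drift 0, and it turns the
    degree of symmetry into the number of flat steps at 0. *)
Lemma sum_degree_of_symmetry (R : realFieldType) (phi : nat -> R) n :
  \sum_(P : grand_dyck n) phi (degree_of_symmetry P) = walk_sum phi n 0.
Proof.
rewrite -[0%N]/(absz 0) -sum_flat_count.
pose f (P : grand_dyck n) := Tuple (size_pair_steps (steps P)).
have fK P : unpair_steps (f P) = P by exact: pair_stepsK.
have drift0 P : \sum_(p <- f P) half_drift p = 0.
  have := valP P; rewrite xpair_eqE => /andP[_].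
  have := height_unpair (f P); rewrite fK size_tuple => -> /=.
  by rewrite mulrn_eq0 => /eqP.
have unP (q : n.-tuple (bool * bool)) : 0 + \sum_(p <- q) half_drift p == 0 ->
    vertex (Tuple (size_unpair_steps q)) n.*2 == (n.*2%:Z, 0).
  rewrite add0r => /eqP q0; rewrite xpair_eqE eqxx.
  by have := height_unpair q; rewrite size_tuple /= => ->; rewrite q0.
rewrite [RHS](reindex f); last first.
  (* The default [zigzag n] is never reached on the sequences summed over: by [unP] they unfold to
     grand Dyck paths. *)
  exists (fun q : n.-tuple _ => insubd (zigzag n) (Tuple (size_unpair_steps q))) => [P _|q].
    apply: val_inj; apply: val_inj; rewrite insubdK /= ?fK//.
    by apply: (unP (f P)); rewrite drift0.
  move=> q0; apply: val_inj; rewrite /f /= insubdK; last exact: unP.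
  by have := unpair_stepsK q; rewrite size_tuple.
apply: eq_big => P; first by rewrite drift0 addr0.
by move=> _; rewrite (flat_count_unpair (fK P) (drift0 P)).
Qed.
End PairedSteps.

(** * Wallis bounds *)

Section MeanValue.
Context {R : realType}.
Implicit Types (f df : R -> R) (a b x : R).

Lemma is_derive_mean_value f df a b : a <= b ->
  (forall x, is_derive x 1 f (df x)) ->
  exists2 c, a <= c <= b & f b - f a = df c * (b - a).
Proof.
move=> ab fdf.
have fc : {within `[a, b], continuous f}.
  by apply: derivable_within_continuous => x _; apply: ex_derive; exact: fdf.
have [c] := MVT_segment ab (fun x _ => fdf x) fc.
by rewrite in_itv/= => cab e; exists c.
Qed.

Lemma lipschitz_is_derive f df (K : R) a b :
  (forall x, is_derive x 1 f (df x)) -> (forall x, `|df x| <= K) ->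
  `|f b - f a| <= K * `|b - a|.
Proof.
move=> fdf dfK; wlog ab : a b / a <= b => [H|].
  by have [/H//|/ltW/H] := leP a b; rewrite distrC [X in _ <= _ * X]distrC.
have [c _ ->] := is_derive_mean_value ab fdf.
by rewrite normrM ler_wpM2r.
Qed.

(** The mean value theorem is applied twice, which gives the constant [K] instead of the sharp
    [K / 2]. *)
Lemma taylor1_is_derive f df d2f (K : R) a b :
  (forall x, is_derive x 1 f (df x)) -> (forall x, is_derive x 1 df (d2f x)) ->
  (forall x, `|d2f x| <= K) ->
  `|f b - f a - df a * (b - a)| <= K * (b - a) ^+ 2.
Proof.
move=> fdf dfd2f d2fK.
have K0 : 0 <= K by exact: le_trans (d2fK 0).
suff [c ca ->] : exists2 c, `|c - a| <= `|b - a| & f b - f a = df c * (b - a).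
  rewrite -mulrBl normrM -[(b - a) ^+ 2]ger0_norm ?sqr_ge0// normrX expr2 mulrA.
  rewrite ler_wpM2r//; apply: le_trans (lipschitz_is_derive _ _ dfd2f d2fK) _.
  by rewrite ler_wpM2l.
have [ab|/ltW ba] := leP a b.
  have [c cab e] := is_derive_mean_value ab fdf; exists c => //.
  by rewrite !ger0_norm; lra.
have [c cab e] := is_derive_mean_value ba fdf; exists c.
  by rewrite !ler0_norm; lra.
by rewrite -[LHS]opprB e; ring.
Qed.
End MeanValue.

Section Wallis.
Context {R : realType}.
Implicit Types (n : nat) (x : R).

(* The reduction formula for the Wallis integrals, read on primitives: no
   integral is needed to compare their values at pi / 2. *)
Fixpoint cos_primitive n : R -> R :=
  match n with
  | 0 => id
  | 1 => sin
  | n'.+2 => n'.+2%:R^-1 *: (cos ^+ n'.+1 * sin + n'.+1%:R *: cos_primitive n')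
  end.

Lemma is_derive_cos_primitive n x :
  is_derive x 1 (cos_primitive n) (cos x ^+ n).
Proof.
elim/ltn_ind: n x => -[|[|n]] IH x; first by rewrite expr0; exact: is_derive_id.
  by rewrite expr1; exact: is_derive_sin.
have dIH := IH n (leqnSn _) x.
have dc : is_derive x 1 (cos ^+ n.+1 : R -> R) _ := is_deriveX n.+1 (is_derive_cos x).
have dM := is_deriveM dc (is_derive_sin x).
have dD := is_deriveD dM (is_deriveZ n.+1%:R dIH).
apply: (is_derive_eq (is_deriveZ n.+2%:R^-1 dD)).
rewrite /GRing.scale/= !fctE -[n.+2%:R]natr1 -[n.+1%:R]natr1 !exprS.
have := cos2Dsin2 x; rewrite !expr2 => cs.
have n0 : n%:R + 1 + 1 != 0 :> R by rewrite !natr1 pnatr_eq0.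
set c := cos x in cs *; set s := sin x in cs *; set p := c ^+ n.
apply: (mulfI n0); rewrite mulVKf//.
transitivity (c * p * c - (n%:R + 1) * p * (s * s) + (n%:R + 1) * p).
  by ring.
by rewrite (_ : s * s = 1 - c * c); [ring|rewrite -cs; ring].
Qed.

Definition wallis n : R := cos_primitive n (pi / 2).

Lemma wallisSS n : n.+2%:R * wallis n.+2 = n.+1%:R * wallis n.
Proof.
rewrite /wallis /= !fctE cos_pihalf expr0n/= mul0r add0r /GRing.scale/=.
by rewrite mulVKf ?pnatr_eq0.
Qed.

(** Both primitives vanish at 0, and their difference has derivative [(1 - cos c) * cos c ^+ n],
    nonnegative up to [pi / 2]. *)
Lemma wallis_nonincreasing n : wallis n.+1 <= wallis n.
Proof.
have F0 m : cos_primitive m 0 = 0.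
  elim/ltn_ind: m => -[|[|m]] IH //=; first exact: sin0.
  by rewrite !fctE sin0 IH// !scaler0 mulr0 addr0 scaler0.
have pi0 : 0 <= pi / 2 :> R by rewrite divr_ge0// pi_ge0.
have d x := is_deriveB (is_derive_cos_primitive n x) (is_derive_cos_primitive n.+1 x).
have [c /andP[c0 cpi]] := is_derive_mean_value pi0 d.
rewrite !fctE !F0 !subr0 -/(wallis n) -/(wallis n.+1) => e.
have cn : 0 <= cos c ^+ n.
  by rewrite exprn_ge0// cos_ge0_pihalf// cpi andbT; lra.
rewrite -subr_ge0 e (_ : _ - _ = (1 - cos c) * cos c ^+ n); last by rewrite exprS; ring.
by rewrite !mulr_ge0 ?pi_ge0// subr_ge0 cos_le1.
Qed.
End Wallis.

(** * Two-sided bounds on central binomial coefficients *)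

Section CentralBinomial.
Context {R : realType}.
Implicit Types n : nat.

(** Return probability of the simple walk after [2n] steps, of order [1 / sqrt (pi n)]. *)
Definition central n : R := 'C(n.*2, n)%:R / 4 ^+ n.

Lemma central_gt0 n : 0 < central n.
Proof. by rewrite divr_gt0 ?exprn_gt0// ltr0n bin_gt0; lia. Qed.

Lemma centralS n : 2 * n.+1%:R * central n.+1 = (2 * n%:R + 1) * central n.
Proof.
have := mul_bin_left n.*2 n; have := binD0 n.
rewrite (_ : n.*2 - n = n)%N; last lia.
move/(congr1 (fun x => x%:R : R)); rewrite natrD !natrM => e1.
move/(congr1 (fun x => x%:R : R)); rewrite !natrM => e2.
have n0 : 4 ^+ n != 0 :> R by rewrite expf_neq0.
rewrite /central e1 exprS; apply: (mulIf n0).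
rewrite -[RHS]mulrA divfK//.
transitivity (n.+1%:R * 'C(n.*2, n.+1)%:R + n.+1%:R * 'C(n.*2, n)%:R : R); first by field.
by rewrite e2 -natr1; ring.
Qed.

(** The two-step recursion of [wallis] is that of [central] on even indices and of its inverse on
    odd ones; [pi] enters through the initial value [wallis 0 = pi / 2]. *)
Lemma wallis_central n : wallis n.*2 = pi / 2 * central n :> R /\
  (2 * n%:R + 1) * wallis n.*2.+1 * central n = 1 :> R.
Proof.
elim: n => [|n [IH1 IH2]].
  by rewrite /central /wallis /= bin0 expr0 divr1 sin_pihalf !(mulr1, mulr0, add0r).
have cS := centralS n.
have eS : n.*2.+2%:R = 2 * n.+1%:R :> R by rewrite -doubleS -mul2n natrM.
have eS1 : n.*2.+1%:R = 2 * n%:R + 1 :> R by rewrite -natr1 -mul2n natrM.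
have eS3 : n.*2.+3%:R = 2 * n.+1%:R + 1 :> R by rewrite -natr1 eS.
have n0 : 2 * n.+1%:R != 0 :> R by rewrite mulf_neq0.
rewrite doubleS; split.
  apply: (mulfI n0); rewrite -{1}eS wallisSS eS1 IH1 mulrCA [RHS]mulrCA cS; ring.
have := @wallisSS R n.*2.+1; rewrite eS3 eS => ->.
transitivity (2 * n.+1%:R * central n.+1 * wallis n.*2.+1); first by ring.
by rewrite cS -[RHS]IH2; ring.
Qed.

(** This bound compares the Wallis values at [2n - 1] and [2n]; the lower bound below compares those
    at [2n] and [2n + 1]. *)
Lemma central_sqr_le n : pi * n%:R * central n ^+ 2 <= 1.
Proof.
case: n => [|n]; first by rewrite mulr0 mul0r.
have [e1 _] := wallis_central n.+1; have [_ e3] := wallis_central n.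
have := @wallis_nonincreasing R n.*2.+1; rewrite -doubleS e1.
have b0 := central_gt0 n; have b1 := central_gt0 n.+1; have cS := centralS n.
move=> le.
have : pi / 2 * central n.+1 * ((2 * n%:R + 1) * central n) <= 1.
  have k0 : 0 <= (2 * n%:R + 1) * central n by rewrite mulr_ge0 ?ltW// ltr_wpDl.
  apply: le_trans (ler_wpM2r k0 le) _.
  by rewrite -[leRHS]e3 mulrCA mulrA.
by rewrite -cS; apply: le_trans; rewrite le_eqVlt; apply/orP; left; apply/eqP; field.
Qed.

Lemma central_sqr_ge n : 1 <= pi * (n%:R + 2^-1) * central n ^+ 2.
Proof.
have [e1 e2] := wallis_central n; have b0 := central_gt0 n.
have := @wallis_nonincreasing R n.*2; rewrite e1 => le.
rewrite -[leLHS]e2 expr2 mulrA ler_pM2r//.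
rewrite (_ : pi * _ * central n = (2 * n%:R + 1) * (pi / 2 * central n)); last by field.
by rewrite ler_wpM2l.
Qed.
End CentralBinomial.

(** * Gaussian estimates *)

Section ExpBounds.
Context {R : realType}.
Implicit Types (a b u t x : R) (N n j J : nat).

Lemma mul_expRN_le1 u : u * expR (- u) <= 1.
Proof.
rewrite expRN ler_pdivrMr ?expR_gt0// mul1r.
by apply: le_trans (expR_ge1Dx u); lra.
Qed.

Lemma sqr_expRN_le u : 0 <= u -> u ^+ 2 * expR (- u) <= 4.
Proof.
move=> u0; have h := mul_expRN_le1 (u / 2).
rewrite (_ : - u = - (u / 2) + - (u / 2)) ?expRD; last by field.
have h0 : 0 <= u / 2 * expR (- (u / 2)) by rewrite mulr_ge0 ?expR_ge0; lra.
rewrite (_ : u ^+ 2 * _ = 4 * (u / 2 * expR (- (u / 2))) ^+ 2); last by field.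
by rewrite ger_pMr// exprn_ile1.
Qed.

Lemma expRB_le a b : expR (- a) - expR (- b) <= expR (- a) * (b - a).
Proof.
have h := expR_ge1Dx (a - b); rewrite -subr_ge0.
have -> : expR (- b) = expR (- a) * expR (a - b) by rewrite -expRD; congr expR; ring.
rewrite (_ : _ - _ = expR (- a) * (expR (a - b) - (1 + (a - b)))); last by ring.
by rewrite mulr_ge0 ?expR_ge0// subr_ge0.
Qed.

(** Consecutive binomials have ratio [1 - (2 j + 1) / (N + j + 1)], at most
    [expR (- ((2 j + 1) / (N + J)))], and the odd numbers add up to [j ^+ 2]. Fixing [J] keeps the
    denominator constant during the induction. *)
Lemma bin_ratio_le N j J : (j <= J)%N ->
  'C(N.*2, N + j)%:R <= 'C(N.*2, N)%:R * expR (- (j%:R ^+ 2 / (N + J)%:R)) :> R.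
Proof.
elim: j => [|j IH] jJ; first by rewrite addn0 expr0n mul0r oppr0 expR0 mulr1.
have [Nj|jN] := leqP N j.
  by rewrite bin_small ?mulr_ge0 ?expR_ge0//; lia.
have := mul_bin_left N.*2 (N + j); rewrite (_ : N.*2 - (N + j) = N - j)%N; last lia.
move/(congr1 (fun m : nat => m%:R : R)); rewrite !natrM natrB 1?ltnW// -addnS => e.
have d0 : 0 < (N + j.+1)%:R :> R by rewrite ltr0n; lia.
rewrite -(ler_pM2l d0) e.
have {}IH := IH (ltnW jJ); set B := 'C(_, _)%:R in IH *.
have NJ : (N + j.+1)%:R <= (N + J)%:R :> R by rewrite ler_nat; lia.
move: (N + J)%:R IH NJ => D IH NJ.
have D0 : 0 < D by exact: lt_le_trans NJ.
have step : N%:R - j%:R <= (N + j.+1)%:R * expR (- ((2 * j%:R + 1) / D)).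
  have -> : N%:R - j%:R = (N + j.+1)%:R * (1 - (2 * j%:R + 1) / (N + j.+1)%:R) :> R.
    rewrite mulrBr mulr1 mulrCA divff ?gt_eqF// mulr1 natrD -natr1; ring.
  rewrite ler_pM2l//; apply: le_trans (expR_ge1Dx _).
  rewrite lerD2l lerN2 ler_pM2l ?ltr_wpDl//.
  by rewrite lef_pV2 ?posrE.
have jN' : 0 <= N%:R - j%:R :> R by rewrite subr_ge0 ler_nat ltnW.
rewrite (_ : - (j.+1%:R ^+ 2 / D) = - (j%:R ^+ 2 / D) + - ((2 * j%:R + 1) / D)); last first.
  by rewrite -natr1; field; rewrite gt_eqF.
rewrite expRD.
rewrite (_ : (N + j.+1)%:R * _ =
  ((N + j.+1)%:R * expR (- ((2 * j%:R + 1) / D))) *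
  ('C(N.*2, N)%:R * expR (- (j%:R ^+ 2 / D)))); last by ring.
by apply: ler_pM.
Qed.

(** The same product read upside down: the inverse ratio is [1 + (2 j + 1) / (N - j)], and [N - j]
    is at least [N + 1 - J] as long as the next index is at most [J]. *)
Lemma bin_ratio_ge N j J : (j <= J)%N -> (J <= N)%N ->
  'C(N.*2, N)%:R * expR (- (j%:R ^+ 2 / (N.+1 - J)%:R)) <= 'C(N.*2, N + j)%:R :> R.
Proof.
move=> + JN; elim: j => [|j IH] jJ; first by rewrite addn0 expr0n mul0r oppr0 expR0 mulr1.
have := mul_bin_left N.*2 (N + j); rewrite (_ : N.*2 - (N + j) = N - j)%N; last lia.
move/(congr1 (fun m : nat => m%:R : R)); rewrite !natrM natrB -?addnS => [e|]; last lia.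
have d0 : 0 < (N + j.+1)%:R :> R by rewrite ltr0n; lia.
rewrite -(ler_pM2l d0) e.
have {}IH := IH (ltnW jJ); set B := 'C(_, N + j)%:R in IH *.
have D0 : 0 < (N.+1 - J)%:R :> R by rewrite ltr0n; lia.
have NJ : (N.+1 - J)%:R <= N%:R - j%:R :> R by rewrite -natrB ?ler_nat; lia.
move: (N.+1 - J)%:R D0 IH NJ => D D0 IH NJ.
have Nj0 : 0 < N%:R - j%:R :> R by exact: lt_le_trans NJ.
have step : (N + j.+1)%:R * expR (- ((2 * j%:R + 1) / D)) <= N%:R - j%:R.
  rewrite expRN ler_pdivrMr ?expR_gt0//.
  have -> : (N + j.+1)%:R = (N%:R - j%:R) * (1 + (2 * j%:R + 1) / (N%:R - j%:R)) :> R.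
    by rewrite natrD -natr1; field; rewrite gt_eqF.
  rewrite ler_pM2l//; apply: le_trans (expR_ge1Dx _) _.
  by rewrite ler_expR ler_pM2l ?ltr_wpDl// lef_pV2 ?posrE.
rewrite (_ : - (j.+1%:R ^+ 2 / D) = - (j%:R ^+ 2 / D) + - ((2 * j%:R + 1) / D)); last first.
  by rewrite -natr1; field; rewrite gt_eqF.
rewrite expRD.
rewrite (_ : (N + j.+1)%:R * _ =
  ((N + j.+1)%:R * expR (- ((2 * j%:R + 1) / D))) *
  ('C(N.*2, N)%:R * expR (- (j%:R ^+ 2 / D)))); last by ring.
by apply: ler_pM; rewrite ?mulr_ge0 ?expR_ge0.
Qed.
End ExpBounds.

(** * Gaussian approximation of binomial ratios *)

Section GaussRatio.
Context {R : realType}.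
Implicit Types (a b s u t x : R) (N n j J : nat).

(* AM-GM, [2 j / s <= 1 + j^2 / s^2], keeps the odd powers of [j / s] out. *)
Lemma le_amgm x s : 0 < s -> 2 * (x / s) <= 1 + x ^+ 2 / s ^+ 2.
Proof.
move=> s0; rewrite -expr_div_n; set y := x / s.
by have := sqr_ge0 (1 - y); lra.
Qed.

(** In the main range the ratio lies between two Gaussians whose exponents differ from [j ^+ 2 / N]
    by order [j ^+ 3 / N ^+ 2]; the Gaussian factor turns this into order [1 / sqrt N]. *)
Lemma bin_ratio_gauss N j : (0 < N)%N ->
  `|'C(N.*2, N + j)%:R / 'C(N.*2, N)%:R - expR (- (j%:R ^+ 2 / N%:R))|
    <= 5 / Num.sqrt N%:R :> R.
Proof.
move=> N0; have n0 : 0 < N%:R :> R by rewrite ltr0n.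
set s := Num.sqrt N%:R; have s0 : 0 < s by rewrite sqrtr_gt0.
have sE : N%:R = s ^+ 2 by rewrite sqr_sqrtr// ltW.
have s1 : 1 <= s by rewrite -sqrtr1 ler_sqrt// ler1n.
have C0 : 0 < 'C(N.*2, N)%:R :> R by rewrite ltr0n bin_gt0; lia.
set v := j%:R ^+ 2 / N%:R; have v0 : 0 <= v by rewrite divr_ge0 ?sqr_ge0.
set r := _ / 'C(N.*2, N)%:R; have r0 : 0 <= r by rewrite divr_ge0.
have jv : 2 * (j%:R / s) <= 1 + v by rewrite /v sE; exact: le_amgm.
rewrite ler_norml; apply/andP; split.
  (* Past [N / 2] the Gaussian alone is small: [v >= N / 4 >= s / 4] and [v * expR (- v) <= 1] bound
     it by [4 / s]. *)
  rewrite lerNl opprB; have [Nj2|jN2] := ltnP N j.*2.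
    have N2j : N%:R <= 2 * j%:R :> R by rewrite -natrM ler_nat; lia.
    have vN : N%:R / 4 <= v.
      rewrite /v ler_pdivlMr// mulrAC ler_pdivrMr// -!expr2.
      rewrite (_ : _ * 4 = (2 * j%:R) ^+ 2); last by ring.
      by rewrite ler_sqr ?nnegrE.
    have vs : s / 4 <= v.
      by apply: le_trans vN; rewrite ler_pM2r// sE expr2 ler_peMr// ltW.
    have ve := mul_expRN_le1 v.
    apply: le_trans (_ : expR (- v) <= _); first by lra.
    apply: le_trans (_ : 4 / s <= _); last by rewrite ler_pM2r ?invr_gt0//; lra.
    rewrite ler_pdivlMr//.
    by have := ler_wpM2r (expR_ge0 (- v)) vs; lra.
  have jN : (j <= N)%N by lia.
  have := @bin_ratio_ge R N j j (leqnn j) jN.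
  rewrite mulrC -ler_pdivlMr// -/r natrB 1?leqW// -natr1.
  set D := N%:R + 1 - j%:R => wr.
  have N2j : 2 * j%:R <= N%:R :> R by rewrite -natrM ler_nat; lia.
  have D0 : 0 < D by rewrite /D; lra.
  apply: le_trans (_ : expR (- v) - expR (- (j%:R ^+ 2 / D)) <= _); first lra.
  apply: le_trans (expRB_le _ _) _.
  (* The constant 5 arises here: [(v + v ^+ 2) * expR (- v) <= 1 + 4]. *)
  have dv : j%:R ^+ 2 / D - v <= v * (1 + v) / s.
    apply: le_trans (_ : v * (2 * (j%:R / s)) / s <= _); last first.
      by rewrite ler_pM2r ?invr_gt0// ler_wpM2l.
    rewrite (_ : v * _ / s = v * (2 * j%:R / N%:R)); last first.
      by rewrite sE; field; rewrite gt_eqF.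
    rewrite (_ : _ - v = v * ((N%:R - D) / D)); last first.
      by rewrite /v; field; rewrite !gt_eqF.
    rewrite ler_wpM2l// ler_pdivrMr// mulrAC ler_pdivlMr//.
    by rewrite /D; have : 0 <= j%:R :> R by []; nra.
  apply: le_trans (ler_wpM2l (expR_ge0 _) dv) _.
  rewrite mulrA ler_pM2r ?invr_gt0//.
  by have := mul_expRN_le1 v; have := sqr_expRN_le v0; lra.
have [jN|Nj] := leqP j N; last first.
  rewrite /r bin_small ?mul0r; last lia.
  rewrite sub0r; apply: le_trans (_ : 0 <= _); last by rewrite divr_ge0// ltW.
  by rewrite oppr_le0 expR_ge0.
have := @bin_ratio_le R N j j (leqnn j).
rewrite mulrC -ler_pdivrMr// -/r natrD.
set D := N%:R + j%:R => rw.
have jN' : j%:R <= N%:R :> R by rewrite ler_nat.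
have D0 : 0 < D by rewrite /D ltr_wpDr.
set u := j%:R ^+ 2 / D in rw; have u0 : 0 <= u by rewrite divr_ge0 ?sqr_ge0// ltW.
apply: le_trans (_ : expR (- u) - expR (- v) <= _); first lra.
apply: le_trans (expRB_le _ _) _.
have dv : v - u <= u * (1 + 2 * u) / 2 / s.
  have vu : v <= 2 * u.
    rewrite /v /u mulrCA ler_wpM2l ?sqr_ge0// ler_pdivlMr// mulrC ler_pdivrMr//.
    by rewrite /D; lra.
  rewrite (_ : v - u = u * (2 * (j%:R / s)) / 2 / s); last first.
    by rewrite /v /u /D sE; field; rewrite -sE !gt_eqF.
  rewrite ler_pM2r ?invr_gt0// ler_pM2r ?invr_gt0// ler_wpM2l//; lra.
apply: le_trans (ler_wpM2l (expR_ge0 _) dv) _.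
rewrite mulrA ler_pM2r ?invr_gt0//.
by have := mul_expRN_le1 u; have := sqr_expRN_le u0; lra.
Qed.
End GaussRatio.

(** * The Rayleigh profile, its derivatives and its Taylor bounds *)

Section GaussProfile.
Context {R : realType}.
Implicit Types (a b c s t x : R).

Lemma is_derive_gauss c t :
  is_derive t 1 (fun t => expR (- (c * t) ^+ 2))
    (- (2 * c ^+ 2 * t) * expR (- (c * t) ^+ 2)).
Proof.
have d1 := is_deriveN (is_deriveX 2 (is_deriveZ c (is_derive_id t (1 : R)))).
apply: (is_derive_eq (is_derive1_comp (is_derive_expR _) d1)).
by rewrite !fctE /GRing.scale/= -[c *: t]/(c * t); ring.
Qed.

Lemma is_derive_mul_gauss (p : {poly R}) c t :
  is_derive t 1 (fun t => p.[t] * expR (- (c * t) ^+ 2))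
    ((p^`().[t] - 2 * c ^+ 2 * t * p.[t]) * expR (- (c * t) ^+ 2)).
Proof.
have dp : is_derive t 1 (horner p) p^`().[t] by exact: is_derive_poly.
apply: (is_derive_eq (is_deriveM dp (is_derive_gauss c t))).
by rewrite /GRing.scale/=; ring.
Qed.

(* The limiting Rayleigh density is 2 psi. *)
Definition psi t : R := t * expR (- t ^+ 2).
Definition dpsi t : R := (1 - 2 * t ^+ 2) * expR (- t ^+ 2).

Lemma is_derive_psi t : is_derive t 1 psi (dpsi t).
Proof.
have := is_derive_mul_gauss 'X 1 t; rewrite derivX hornerX -polyC1 hornerC.
have -> : (fun t => 'X.[t] * expR (- (1 * t) ^+ 2)) = psi.
  by apply/funext => x; rewrite /psi hornerX mul1r.
by move/is_derive_eq; apply; rewrite /dpsi mul1r; ring.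
Qed.

Lemma is_derive_dpsi t :
  is_derive t 1 dpsi ((4 * t ^+ 3 - 6 * t) * expR (- t ^+ 2)).
Proof.
have := is_derive_mul_gauss (1 - 2 *: 'X^2) 1 t.
have -> : (fun t => (1 - 2 *: 'X^2).[t] * expR (- (1 * t) ^+ 2)) = dpsi.
  by apply/funext => x; rewrite /dpsi !hornerE.
move/is_derive_eq; apply; rewrite -polyC1 derivB derivC derivZ derivXn !hornerE /=; ring.
Qed.

Lemma is_derive_gauss_tail t :
  is_derive t 1 (fun t => - expR (- t ^+ 2)) (2 * psi t).
Proof.
have := is_deriveN (is_derive_gauss 1 t).
have -> : - (fun t => expR (- (1 * t) ^+ 2)) = (fun t => - expR (- t ^+ 2)).
  by apply/funext => x; rewrite fctE mul1r.
by move/is_derive_eq; apply; rewrite /psi mul1r; ring.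
Qed.

(** Since [|t| <= (1 + t ^+ 2) / 2], only even powers remain, and these are controlled by the bounds
    on [u * expR (- u)] and [u ^+ 2 * expR (- u)] at [u = t ^+ 2]. *)
Lemma norm_poly3_gauss_le (p q t : R) : 0 <= p -> 0 <= q ->
  `|(p * t ^+ 3 - q * t) * expR (- t ^+ 2)| <= 5 * p + q.
Proof.
move=> p0 q0; have e0 := expR_ge0 (- t ^+ 2).
rewrite normrM [X in _ * X]ger0_norm//.
have le : `|p * t ^+ 3 - q * t| <= 2^-1 * (1 + t ^+ 2) * (p * t ^+ 2 + q).
  have := mulr_ge0 p0 (sqr_ge0 (t * (1 + t))).
  have := mulr_ge0 p0 (sqr_ge0 (t * (1 - t))).
  have := mulr_ge0 q0 (sqr_ge0 (1 + t)).
  have := mulr_ge0 q0 (sqr_ge0 (1 - t)).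
  by rewrite ler_norml; lra.
apply: le_trans (ler_wpM2r e0 le) _.
have h1 := mul_expRN_le1 (t ^+ 2); have h2 := sqr_expRN_le (sqr_ge0 t).
have h0 : expR (- t ^+ 2) <= 1 by rewrite expR_le1 oppr_le0 sqr_ge0.
have := ler_wpM2l p0 h1; have := ler_wpM2l p0 h2.
have := ler_wpM2l q0 h1; have := ler_wpM2l q0 h0; lra.
Qed.

Lemma psi_le1 t : `|psi t| <= 1.
Proof.
have := norm_poly3_gauss_le t (lexx 0) ler01.
by rewrite mulr0 add0r mul0r sub0r mul1r mulNr normrN.
Qed.

Lemma dpsi_le3 t : `|dpsi t| <= 3.
Proof.
have e0 := expR_ge0 (- t ^+ 2).
have := mul_expRN_le1 (t ^+ 2); have : expR (- t ^+ 2) <= 1.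
  by rewrite expR_le1 oppr_le0 sqr_ge0.
have : 0 <= t ^+ 2 * expR (- t ^+ 2) by rewrite mulr_ge0 ?sqr_ge0.
by rewrite /dpsi ler_norml; lra.
Qed.

(** The second derivative is the cubic with [p = 4] and [q = 6], whence [26 = 5 * 4 + 6]. *)
Lemma psi_taylor a t : `|psi t - psi a - dpsi a * (t - a)| <= 26 * (t - a) ^+ 2.
Proof.
apply: (taylor1_is_derive _ _ is_derive_psi is_derive_dpsi) => x.
by apply: le_trans (norm_poly3_gauss_le _ _ _) _ => //; lra.
Qed.

(** Compares an increment of the limiting distribution function with its density at [a]; the
    constant 6 is twice the bound on [dpsi]. *)
Lemma gauss_tail_taylor a t :
  `|expR (- a ^+ 2) - expR (- t ^+ 2) - 2 * psi a * (t - a)| <= 6 * (t - a) ^+ 2.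
Proof.
have d2 x : is_derive x 1 (fun t => 2 * psi t) (2 * dpsi x).
  exact: (is_deriveZ 2 (is_derive_psi x)).
have := @taylor1_is_derive _ _ _ _ 6 a t is_derive_gauss_tail d2.
rewrite opprK [- _ + _]addrC; apply=> x.
rewrite normrM ger0_norm//; have := dpsi_le3 x; lra.
Qed.

(** Taken at inverse square roots of two lengths, this exchanges one length for the other. The
    derivative is [x] times a factor bounded by [13 = 5 * 2 + 3]. *)
Lemma scaled_psi_lipschitz c s t : 0 <= c -> 0 < s -> s <= t ->
  `|t ^+ 2 * psi (c * t) - s ^+ 2 * psi (c * s)| <= 13 * (t ^+ 2 - s ^+ 2).
Proof.
move=> c0 s0 st.
have d x : is_derive x 1 (fun t => t ^+ 2 * psi (c * t))
    (- x * ((2 * (c * x) ^+ 3 - 3 * (c * x)) * expR (- (c * x) ^+ 2))).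
  have := is_derive_mul_gauss (c *: 'X^3) c x.
  have -> : (fun t => (c *: 'X^3).[t] * expR (- (c * t) ^+ 2)) =
      (fun t => t ^+ 2 * psi (c * t)).
    by apply/funext => y; rewrite /psi hornerZ hornerXn; ring.
  move/is_derive_eq; apply.
  by rewrite derivZ derivXn hornerZ hornerMn !hornerZ !hornerXn /=; ring.
have [y /andP[sy yt] ->] := is_derive_mean_value st d.
have y0 : 0 < y by exact: lt_le_trans sy.
have ts : 0 <= t - s by rewrite subr_ge0.
rewrite normrM normrM normrN (ger0_norm (ltW y0)) (ger0_norm ts).
have le13 := @norm_poly3_gauss_le 2 3 (c * y) (ler0n _ _) (ler0n _ _).
have t0 : 0 < t by exact: lt_le_trans st.
apply: le_trans (_ : y * 13 * (t - s) <= _).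
  by rewrite ler_wpM2r// ler_wpM2l ?(ltW y0)//; apply: le_trans le13 _; lra.
rewrite (_ : t ^+ 2 - s ^+ 2 = (t + s) * (t - s)); last by ring.
by rewrite mulrA ler_wpM2r ?subr_ge0//; lra.
Qed.
End GaussProfile.

(** * Negative binomial weights *)

Section NegativeBinomial.
Context {R : realFieldType}.
Implicit Types (k m M : nat).

(* Probability that the (k + 1)-st head of a sequence of fair coin tosses comes
   at toss m + 1. *)
Definition negbin k m : R := 'C(m, k)%:R / 2 ^+ m.+1.
Definition negbin_cdf k M : R := \sum_(m < M.+1) negbin k m.

Lemma negbin_ge0 k m : 0 <= negbin k m.
Proof. by rewrite divr_ge0// exprn_ge0. Qed.

Lemma negbinSS k m : 2 * negbin k.+1 m.+1 = negbin k m + negbin k.+1 m.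
Proof.
rewrite /negbin binS natrD [2 ^+ m.+2]exprS.
by field; rewrite expf_neq0// pnatr_eq0.
Qed.

(** The factor [m.+1] is absorbed by raising both indices, which reduces truncated moments to
    distribution functions. *)
Lemma negbin_diag k m : m.+1%:R * negbin k m = 2 * k.+1%:R * negbin k.+1 m.+1.
Proof.
have : m.+1%:R * 'C(m, k)%:R = k.+1%:R * 'C(m.+1, k.+1)%:R :> R.
  by rewrite -!natrM -mul_bin_diag.
rewrite /negbin mulrA => ->; rewrite [2 ^+ m.+2]exprS.
by field; rewrite expf_neq0// pnatr_eq0.
Qed.

Lemma negbin_cdfSS k M :
  negbin_cdf k.+1 M.+1 = negbin_cdf k M - negbin k.+1 M.+1.
Proof.
elim: M => [|M IH].
  rewrite /negbin_cdf !big_ord_recr !big_ord0 /= !add0r.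
  have := negbinSS k 0; rewrite {3}/negbin bin0n mul0r /negbin bin0n mul0r; lra.
rewrite [LHS]/negbin_cdf big_ord_recr /= -/(negbin_cdf _ _) IH.
rewrite [in RHS]/negbin_cdf [in RHS]big_ord_recr /= -/(negbin_cdf _ _).
have := negbinSS k M.+1; lra.
Qed.

Lemma negbin_cdf0 M : negbin_cdf 0 M = 1 - 2 ^- M.+1.
Proof.
elim: M => [|M IH].
  by rewrite /negbin_cdf big_ord1 /negbin bin0 expr1; field.
rewrite /negbin_cdf big_ord_recr /= -/(negbin_cdf _ _) IH /negbin bin0.
by rewrite [2 ^+ M.+2]exprS; field; rewrite expf_neq0// pnatr_eq0.
Qed.

Lemma negbin_cdf_ge0 k M : 0 <= negbin_cdf k M.
Proof. by apply: sumr_ge0 => m _; exact: negbin_ge0. Qed.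

Lemma negbin_cdf_le1 k M : negbin_cdf k M <= 1.
Proof.
elim: k M => [|k IH] M.
  by rewrite negbin_cdf0 gerBl invr_ge0 exprn_ge0.
case: M => [|M]; first by rewrite /negbin_cdf big_ord1 /negbin bin0n mul0r.
by rewrite negbin_cdfSS; have := IH M; have := negbin_ge0 k.+1 M.+1; lra.
Qed.

Lemma negbin_cdf_shift k M :
  \sum_(m < M.+1) negbin k.+1 m.+1 = negbin_cdf k.+1 M.+1.
Proof.
rewrite /negbin_cdf [RHS]big_ord_recl /= [negbin _ 0]/negbin bin0n mul0r add0r.
by [].
Qed.

Lemma negbin_mean k M (a := 2 * k.+1%:R : R) :
  \sum_(m < M.+1) (m.+1%:R - a) * negbin k m = - a * negbin k.+1 M.+1.
Proof.
under eq_bigr => m _ do rewrite mulrBl negbin_diag.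
rewrite sumrB -!mulr_sumr negbin_cdf_shift -/(negbin_cdf k M) negbin_cdfSS -/a.
ring.
Qed.

(** The full variance is also [a]; the last term is the exact effect of the truncation. Writing
    [(m + 1)^2] as [(m + 1)(m + 2) - (m + 1)] lets [negbin_diag] apply twice. *)
Lemma negbin_var k M (a := 2 * k.+1%:R : R) :
  \sum_(m < M.+1) (m.+1%:R - a) ^+ 2 * negbin k m =
  a * negbin_cdf k M + a * negbin k.+1 M.+1 * (a - 3 - M%:R).
Proof.
have E m : (m.+1%:R - a) ^+ 2 * negbin k m =
    a * (a + 2) * negbin k.+2 m.+2 - (1 + 2 * a) * a * negbin k.+1 m.+1 +
    a ^+ 2 * negbin k m.
  have d1 := negbin_diag k m; have := negbin_diag k.+1 m.+1.
  rewrite -[k.+2%:R]natr1 -[m.+2%:R]natr1 -/a => d2.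
  transitivity ((m.+1%:R + 1) * (m.+1%:R * negbin k m) -
    (1 + 2 * a) * (m.+1%:R * negbin k m) + a ^+ 2 * negbin k m); first ring.
  rewrite d1 -/a [X in X - _ + _]mulrCA d2 /a; ring.
rewrite (eq_bigr _ (fun (i : 'I_M.+1) _ => E i)) big_split sumrB /= -!mulr_sumr.
have -> : \sum_(m < M.+1) negbin k.+2 m.+2 = negbin_cdf k.+2 M.+2.
  rewrite -negbin_cdf_shift [RHS]big_ord_recl /= [X in _ = X + _]/negbin.
  by rewrite bin_small// mul0r add0r.
rewrite negbin_cdf_shift -/(negbin_cdf k M) !negbin_cdfSS.
have := negbin_diag k.+1 M.+1.
rewrite -[k.+2%:R]natr1 -[M.+2%:R]natr1 -[M.+1%:R]natr1.
set w1 := negbin k.+1 _; set w2 := negbin k.+2 _ => e.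
have {e} : (a + 2) * w2 = (M%:R + 1 + 1) * w1 by rewrite e /a; ring.
move=> e; transitivity (a * (a + 2) * (negbin_cdf k M - w1) - a * ((a + 2) * w2)
  - (1 + 2 * a) * a * (negbin_cdf k M - w1) + a ^+ 2 * negbin_cdf k M); first ring.
by rewrite e; ring.
Qed.

(** The truncated variance is nonnegative, and its exact value contains this product with a minus
    sign. *)
Lemma negbin_tail k M : negbin k.+1 M.+1 * (M%:R + 3 - 2 * k.+1%:R) <= 1.
Proof.
have := negbin_cdf_le1 k M; apply: le_trans.
have /= := negbin_var k M; set S := \sum_(m < _) _ => e.
have : 0 <= S by apply: sumr_ge0 => m _; rewrite mulr_ge0 ?sqr_ge0 ?negbin_ge0.
rewrite e (_ : _ + _ = 2 * k.+1%:R * (negbin_cdf k M -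
  negbin k.+1 M.+1 * (M%:R + 3 - 2 * k.+1%:R))); last by ring.
by rewrite pmulr_rge0 ?mulr_gt0// subr_ge0.
Qed.

(** Each increment of [k] costs one boundary weight, which [negbin_tail] bounds by the inverse of
    the distance from [k.*2] to [M.+1]. *)
Lemma negbin_cdf_ge k M : (k.*2 <= M)%N ->
  1 - negbin_cdf k M <= k.+1%:R / (M.+1 - k.*2)%:R.
Proof.
elim: k M => [|k IH] M kM.
  rewrite negbin_cdf0 opprB addrC subrK subn0 mul1r.
  by rewrite lef_pV2 ?posrE ?exprn_gt0// -natrX ler_nat ltnW// ltn_expl.
case: M kM => // M kM; rewrite negbin_cdfSS.
have kM' : (k.*2 <= M)%N by lia.
have := IH M kM'; have := negbin_tail k M.
set w := negbin _ _; have w0 : 0 <= w by exact: negbin_ge0.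
set D := (M.+1 - k.*2)%:R => t IHM.
have D0 : 0 < (M.+2 - k.+1.*2)%:R :> R by rewrite ltr0n; lia.
have DD : (M.+2 - k.+1.*2)%:R <= D by rewrite ler_nat; lia.
have D0' : 0 < D by exact: lt_le_trans DD.
have wD : w <= D^-1.
  rewrite -[D^-1]mul1r ler_pdivlMr//; apply: le_trans t; rewrite ler_wpM2l//.
  rewrite /D natrB; last lia.
  by rewrite -mul2n natrM -!natr1; lra.
apply: le_trans (_ : k.+2%:R / D <= _).
  by rewrite -[k.+2%:R]natr1 mulrDl mul1r; lra.
by rewrite ler_wpM2l// lef_pV2 ?posrE.
Qed.
End NegativeBinomial.

(** * Local limit *)

Section LocalLimit.
Context {R : realType}.
Implicit Types (N n j k m : nat).

Lemma pi_le4 : pi <= 4 :> R.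
Proof. by have /andP[_ +] := @pihalf_02 R; lra. Qed.

(** By the Wallis bounds the squares of both quantities differ by order [1 / n]; dividing by their
    sum, which is at least 1, gives the claim. *)
Lemma central_ratio_close n N : (0 < N)%N -> (N <= n)%N -> (n <= N.*2)%N ->
  `|central N / central n - Num.sqrt n%:R / Num.sqrt N%:R| <= 3 / n%:R :> R.
Proof.
move=> N0 Nn nN2.
have n0 : 0 < n%:R :> R by rewrite ltr0n; lia.
have N0' : 0 < N%:R :> R by rewrite ltr0n.
have Nn' : N%:R <= n%:R :> R by rewrite ler_nat.
have nN' : n%:R <= 2 * N%:R :> R by rewrite -natrM ler_nat; lia.
have c0 := @central_gt0 R N; have b0 := @central_gt0 R n.
set s := Num.sqrt n%:R; set t := Num.sqrt N%:R.
have s0 : 0 < s by rewrite sqrtr_gt0.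
have t0 : 0 < t by rewrite sqrtr_gt0.
have sE : s ^+ 2 = n%:R by rewrite sqr_sqrtr// ltW.
have tE : t ^+ 2 = N%:R by rewrite sqr_sqrtr// ltW.
set q := _ / central n; set rho := s / t.
have q0 : 0 < q by rewrite divr_gt0.
have rho1 : 1 <= rho by rewrite ler_pdivlMr// mul1r ler_sqrt// ltW.
have rhoE : rho ^+ 2 = n%:R / N%:R by rewrite expr_div_n sE tE.
have p0 : 0 < pi :> R := pi_gt0 R.
have qE : central N = q * central n by rewrite /q divfK// gt_eqF.
have c1 := @central_sqr_le R N; have c2 := @central_sqr_ge R N.
have b1 := @central_sqr_le R n; have b2 := @central_sqr_ge R n.
have B0 : 0 < pi * central n ^+ 2 :> R by rewrite mulr_gt0// exprn_gt0.
have qu : q ^+ 2 * N%:R <= n%:R + 2^-1.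
  rewrite -(ler_pM2r B0); move: c1 b2; rewrite qE; lra.
have ql : n%:R <= q ^+ 2 * (N%:R + 2^-1).
  rewrite -(ler_pM2r B0); move: c2 b1; rewrite qE; lra.
have q4 : q ^+ 2 <= 3.
  by rewrite -(ler_pM2r N0'); have : 1 <= N%:R :> R; [rewrite ler1n|lra].
have d1 : `|q ^+ 2 - rho ^+ 2| <= 3 / n%:R.
  have : `|q ^+ 2 * N%:R - n%:R| <= 3 / 2 by rewrite ler_norml; lra.
  rewrite (_ : q ^+ 2 * N%:R - n%:R = (q ^+ 2 - rho ^+ 2) * N%:R); last first.
    by rewrite rhoE; field; rewrite gt_eqF.
  rewrite normrM [X in _ * X]ger0_norm// => h.
  rewrite ler_pdivlMr//; apply: le_trans (ler_wpM2l _ nN') _ => //.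
  by rewrite mulrCA; lra.
have qr0 : 0 < q + rho by lra.
have : `|q - rho| * (q + rho) <= 3 / n%:R.
  rewrite -[X in _ * X](gtr0_norm qr0) -normrM.
  by rewrite (_ : _ * _ = q ^+ 2 - rho ^+ 2); last by ring.
apply: le_trans; rewrite ler_peMr//; lra.
Qed.

(** By the ballot formula the ratio is [j / N * q * r]. Replacing in turn [q] by [sqrt (n / N)], [r]
    by its Gaussian and [N] by [n] costs 6, 40 and 26 units. The bound [j <= n - N] makes [j / N]
    small. *)
Lemma first_hit_ratio_close n N j : (0 < N)%N -> (N <= n)%N -> (n <= N.*2)%N ->
    (j <= n - N)%N ->
  `|first_hit N j / 4 ^+ N / central n - psi (j%:R / Num.sqrt n%:R) / Num.sqrt n%:R|
  <= 100 * (n - N)%:R / Num.sqrt n%:R ^+ 3 :> R.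
Proof.
move=> N0 Nn nN2 jnN.
have n0 : 0 < n%:R :> R by rewrite ltr0n; lia.
have N0' : 0 < N%:R :> R by rewrite ltr0n.
have Nn' : N%:R <= n%:R :> R by rewrite ler_nat.
have nN' : n%:R <= 2 * N%:R :> R by rewrite -natrM ler_nat; lia.
have b0 := @central_gt0 R n.
have := central_ratio_close N0 Nn nN2; have := bin_ratio_gauss (R := R) j N0.
set s := Num.sqrt n%:R; set t := Num.sqrt N%:R.
have s0 : 0 < s by rewrite sqrtr_gt0.
have t0 : 0 < t by rewrite sqrtr_gt0.
have sE : n%:R = s ^+ 2 by rewrite sqr_sqrtr// ltW.
have tE : N%:R = t ^+ 2 by rewrite sqr_sqrtr// ltW.
have s1 : 1 <= s by rewrite -sqrtr1 ler_sqrt// ler1n; lia.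
have C0 : 0 < 'C(N.*2, N)%:R :> R by rewrite ltr0n bin_gt0; lia.
set q := _ / central n; set rho := s / t; set r := _ / 'C(N.*2, N)%:R.
set E := expR _ => rE qrho.
have r0 : 0 <= r by rewrite divr_ge0.
have r1 : r <= 1.
  rewrite ler_pdivrMr// mul1r; apply: le_trans (bin_ratio_le N (leqnn j)) _.
  by rewrite ger_pMr// expR_le1 oppr_le0 divr_ge0// sqr_ge0.
have ts : t <= s by rewrite ler_sqrt// ltW.
have rho0 : 0 < rho by rewrite divr_gt0.
have rho2 : rho <= 2.
  rewrite -(@ler_pXn2r _ 2) ?nnegrE ?(ltW rho0)//.
  by rewrite /rho expr_div_n -sE -tE ler_pdivrMr//; lra.
have eF : first_hit N j / 4 ^+ N / central n = j%:R / N%:R * q * r.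
  have := @first_hit_bin R N j; rewrite /q /r [central N]/central => h.
  rewrite (_ : first_hit N j = N%:R^-1 * (N%:R * first_hit N j)); last first.
    by rewrite mulKf// gt_eqF.
  by rewrite h; field; rewrite !gt_eqF// exprn_gt0.
set d := (n - N)%:R; have jd : j%:R <= d :> R by rewrite ler_nat.
have dE : d = s ^+ 2 - t ^+ 2 by rewrite /d natrB// sE tE.
have j0 : 0 <= j%:R :> R by [].
have d0 : 0 <= d by exact: le_trans jd.
have jN2 : j%:R / N%:R <= 2 * d / n%:R.
  rewrite ler_pdivrMr// mulrAC ler_pdivlMr//.
  by rewrite (_ : 2 * d * N%:R = d * (2 * N%:R)) ?ler_pM//; ring.
have jN0 : 0 <= j%:R / N%:R :> R by rewrite divr_ge0.
have e1 : `|j%:R / N%:R * q * r - j%:R / N%:R * rho * r| <= 6 * d / s ^+ 3.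
  rewrite -mulrBl -mulrBr normrM (ger0_norm r0) normrM (ger0_norm jN0).
  apply: le_trans (_ : 2 * d / n%:R * (3 / n%:R) * 1 <= _).
    by apply: ler_pM => //; exact: ler_pM.
  rewrite sE mulr1 (_ : _ * _ = 6 * d / s ^+ 3 / s); last by field; rewrite gt_eqF.
  by rewrite ler_pdivrMr// ler_peMr// !mulr_ge0// invr_ge0 exprn_ge0 ?ltW.
have e2 : `|j%:R / N%:R * rho * r - j%:R / N%:R * rho * E| <= 40 * d / s ^+ 3.
  rewrite -mulrBr normrM normrM (ger0_norm jN0) (gtr0_norm rho0).
  apply: le_trans (_ : 2 * d / n%:R * 2 * (10 / s) <= _).
    apply: ler_pM => //; [by rewrite mulr_ge0// ltW| |].
      by apply: ler_pM => //; exact: ltW.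
    apply: le_trans rE _; rewrite ler_pdivrMr// (_ : _ * t = 10 / rho); last first.
      by rewrite /rho; field; rewrite !gt_eqF.
    by rewrite ler_pdivlMr//; lra.
  by rewrite sE le_eqVlt; apply/orP; left; apply/eqP; field; rewrite gt_eqF.
have e3 : `|j%:R / N%:R * rho * E - psi (j%:R / s) / s| <= 26 * d / s ^+ 3.
  have ss : s^-1 <= t^-1 by rewrite lef_pV2 ?posrE.
  have si0 : 0 < s^-1 by rewrite invr_gt0.
  have := scaled_psi_lipschitz j0 si0 ss.
  rewrite -(ler_pM2l s0) -[X in X * `|_|](gtr0_norm s0) -normrM.
  rewrite (_ : s * _ = j%:R / N%:R * rho * E - psi (j%:R / s) / s); last first.
    have -> : E = expR (- (j%:R / t) ^+ 2) by rewrite /E expr_div_n -tE.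
    by rewrite /psi tE /rho; field; rewrite !gt_eqF.
  move=> /le_trans; apply.
  rewrite !exprVn -sE -tE (_ : _ - _ = d / (n%:R * N%:R)); last first.
    by rewrite dE -sE -tE; field; rewrite !gt_eqF.
  rewrite (_ : 26 * d / s ^+ 3 = s * (13 * (d / (n%:R * (n%:R / 2))))); last first.
    by rewrite sE; field; rewrite gt_eqF.
  rewrite ler_pM2l// ler_pM2l// ler_wpM2l// lef_pV2 ?posrE ?mulr_gt0//.
  by rewrite ler_pM2l//; lra.
rewrite eF.
rewrite (_ : _ - _ = (j%:R / N%:R * q * r - j%:R / N%:R * rho * r) +
  (j%:R / N%:R * rho * r - j%:R / N%:R * rho * E) +
  (j%:R / N%:R * rho * E - psi (j%:R / s) / s)); last by ring.
apply: le_trans (ler_normD _ _) _; apply: le_trans (lerD (ler_normD _ _) e3) _.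
apply: le_trans (lerD (lerD e1 e2) (lexx _)) _.
rewrite -!mulrDl; set z := (s ^+ 3)^-1.
have z0 : 0 <= z by rewrite invr_ge0 exprn_ge0// ltW.
by rewrite ler_wpM2r//; lra.
Qed.
(** The law of the degree of symmetry, as [pmf_sym_rv] confirms. *)
Definition flat_prob n k : R :=
  walk_sum (fun i => (i == k)%:R) n 0 / 'C(n.*2, n)%:R.

Lemma flat_probE n k : flat_prob n k = 2 * \sum_(m < n.+1)
  negbin k m * (first_hit (n - m) (m - k) / 4 ^+ (n - m) / central n).
Proof.
rewrite /flat_prob walk_sum_pred1 mulr_suml mulr_sumr; apply: eq_bigr => m _.
have mn : (m <= n)%N by rewrite -ltnS.
have C0 : 'C(n.*2, n)%:R != 0 :> R by rewrite pnatr_eq0 -lt0n bin_gt0; lia.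
have p2 i : 2 ^+ i != 0 :> R by rewrite expf_neq0.
have p4 : 4 ^+ (n - m) != 0 :> R by rewrite expf_neq0.
(* One factor [2 ^+ m] cancels the weights of the [m] returns, the other normalises [negbin], up to
   the leading factor 2. *)
have e4 : 4 ^+ n = 4 ^+ (n - m) * (2 ^+ m * 2 ^+ m) :> R.
  by rewrite -{1}(subnK mn) exprD -exprMn -natrM.
rewrite addn0 /negbin /central e4 exprS.
by field; rewrite p2 p4 C0.
Qed.

(* Crude, but the negative binomial weights are small where it is used. *)
Lemma first_hit_ratio_far n N j : (0 < n)%N ->
  `|first_hit N j / 4 ^+ N / central n - psi (j%:R / Num.sqrt n%:R) / Num.sqrt n%:R|
  <= 5 * Num.sqrt n%:R :> R.
Proof.
move=> n0; have n0' : 0 < n%:R :> R by rewrite ltr0n.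
have n1 : 1 <= n%:R :> R by rewrite ler1n.
set s := Num.sqrt n%:R.
have s0 : 0 < s by rewrite sqrtr_gt0.
have sE : s ^+ 2 = n%:R by rewrite sqr_sqrtr// ltW.
have s1 : 1 <= s by rewrite -sqrtr1 ler_sqrt// ler1n; lia.
have b0 := @central_gt0 R n.
have bs : (central n)^-1 <= 4 * s.
  rewrite -[_^-1]mul1r ler_pdivrMr// -(@ler_pXn2r _ 2) ?nnegrE ?mulr_ge0 ?(ltW b0) ?(ltW s0)//.
  rewrite expr1n exprMn exprMn sE; apply: le_trans (@central_sqr_ge R n) _.
  rewrite ler_pM2r ?exprn_gt0//.
  apply: le_trans (_ : 4 * (n%:R + 2^-1) <= _); last lra.
  by rewrite ler_wpM2r ?pi_le4//; lra.
have f0 := @first_hit_ge0 R N j; have f1 := @first_hit_le R N j.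
have p4 : 0 < 4 ^+ N :> R by rewrite exprn_gt0.
apply: le_trans (ler_normB _ _) _; rewrite (_ : 5 * s = 4 * s + s); last by ring.
apply: lerD.
  rewrite ger0_norm; last by rewrite !divr_ge0// ltW.
  apply: le_trans bs; rewrite ger_pMl ?invr_gt0//.
  by rewrite ler_pdivrMr// mul1r.
rewrite normrM [X in _ * X]ger0_norm ?invr_ge0 ?(ltW s0)//.
rewrite ler_pdivrMr//; apply: le_trans (psi_le1 _) _.
by rewrite -[leLHS]mulr1 ler_pM.
Qed.

(** For [2 m > n] the crude bound [5 * sqrt n] suffices: [k <= n / 8] puts [m + 1] at distance at
    least [n / 8] from [2 (k + 1)], and [320 / 64 = 5]. *)
Lemma first_hit_ratio_bound n m k : (4 <= n)%N -> (8 * k <= n)%N -> (m <= n)%N ->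
  `|first_hit (n - m) (m - k) / 4 ^+ (n - m) / central n
    - psi ((m - k)%:R / Num.sqrt n%:R) / Num.sqrt n%:R|
  <= 320 * (m.+1%:R + (m.+1%:R - 2 * k.+1%:R) ^+ 2) / Num.sqrt n%:R ^+ 3 :> R.
Proof.
move=> n4 kn mn; have n0 : 0 < n%:R :> R by rewrite ltr0n; lia.
have s0 : 0 < Num.sqrt n%:R :> R by rewrite sqrtr_gt0.
have s3 : 0 < (Num.sqrt n%:R ^+ 3)^-1 :> R by rewrite invr_gt0 exprn_gt0.
have sq : 0 <= (m.+1%:R - 2 * k.+1%:R) ^+ 2 :> R by exact: sqr_ge0.
have m0 : 0 <= m%:R :> R by [].
have [mn2|nm2] := leqP m.*2 n.
  apply: le_trans (_ : 100 * (n - (n - m))%:R / Num.sqrt n%:R ^+ 3 <= _).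
    by apply: first_hit_ratio_close; lia.
  by rewrite (subKn mn) ler_pM2r// -natr1; lra.
apply: le_trans (first_hit_ratio_far _ _ _) _; first lia.
have n2m : n%:R + 1 <= 2 * m%:R :> R by rewrite natr1 -natrM ler_nat; lia.
have k8 : 8 * k%:R <= n%:R :> R by rewrite -natrM ler_nat.
have n4' : 4 <= n%:R :> R by rewrite ler_nat.
rewrite ler_pdivlMr ?exprn_gt0// -[X in _ * X * _]expr1 -mulrA -exprD.
rewrite (_ : _ ^+ (1 + 3) = n%:R ^+ 2); last first.
  by rewrite -[in RHS](sqr_sqrtr (ltW n0)) -exprM.
have : (n%:R / 8) ^+ 2 <= (m.+1%:R - 2 * k.+1%:R) ^+ 2 :> R.
  have h : n%:R / 8 <= m.+1%:R - 2 * k.+1%:R :> R.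
    by rewrite -[m.+1%:R]natr1 -[k.+1%:R]natr1; lra.
  by rewrite ler_pXn2r// nnegrE; lra.
by rewrite -[m.+1%:R]natr1 in sq *; lra.
Qed.

Lemma negbin_mean_le k M :
  \sum_(m < M.+1) m.+1%:R * negbin k m <= 2 * k.+1%:R :> R.
Proof.
under eq_bigr => m _ do rewrite negbin_diag.
by rewrite -mulr_sumr negbin_cdf_shift ler_piMr ?mulr_ge0 ?negbin_cdf_le1.
Qed.

(** Three replacements under the negative binomial average: the first passage ratio by the profile
    ([T1]), the profile by its first order expansion at [k / s] ([T2]), and the averaged expansion
    by its value at [k / s] ([T3]). The mean and variance [a] of [m + 1] control the errors. *)
Lemma flat_prob_small n k : (4 <= n)%N -> (8 * k <= n)%N ->
  `|flat_prob n k - 2 * (psi (k%:R / Num.sqrt n%:R) / Num.sqrt n%:R)| <=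
  50 * 60 * (k.+1%:R / Num.sqrt n%:R ^+ 3 + n%:R^-1).
Proof.
move=> n4 kn; have n0 : 0 < n%:R :> R by rewrite ltr0n; lia.
have k2n : (k.*2 <= n)%N by lia.
have n4' : 4 <= n%:R :> R by rewrite ler_nat.
have k8 : 8 * k%:R <= n%:R :> R by rewrite -natrM ler_nat.
have k0 : 0 <= k%:R :> R by [].
rewrite flat_probE -mulrBr normrM ger0_norm//.
have bound := @first_hit_ratio_bound n _ k n4 kn.
set s := Num.sqrt n%:R in bound *.
have s0 : 0 < s by rewrite sqrtr_gt0.
have sE : n%:R = s ^+ 2 by rewrite sqr_sqrtr// ltW.
pose a : R := 2 * k.+1%:R.
pose z := (s ^+ 3)^-1; have z0 : 0 < z by rewrite invr_gt0 exprn_gt0.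
pose y := n%:R^-1 : R; have y0 : 0 < y by rewrite invr_gt0.
pose S := negbin_cdf k n : R.
have S0 : 0 <= S by exact: negbin_cdf_ge0.
have S1 : S <= 1 by exact: negbin_cdf_le1.
pose V : R := \sum_(m < n.+1) (m.+1%:R - a) ^+ 2 * negbin k m.
pose D : R := \sum_(m < n.+1) (m.+1%:R - a) * negbin k m.
have aE : a = 2 * k%:R + 2 by rewrite /a -natr1; ring.
have W0 : 0 <= negbin k.+1 n.+1 :> R by exact: negbin_ge0.
have Va : V <= a.
  rewrite /V negbin_var -/a -/S.
  have : 0 <= a * negbin k.+1 n.+1 * (3 + n%:R - a).
    by rewrite !mulr_ge0//; lra.
  have : a * S <= a by rewrite ler_piMr//; lra.
  lra.
have aW1 : a * negbin k.+1 n.+1 <= 1.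
  apply: le_trans (negbin_tail k n); rewrite mulrC ler_wpM2l//.
  by rewrite -/a; lra.
have DE : D = - (a * negbin k.+1 n.+1) by rewrite /D negbin_mean mulNr.
have aW0 : 0 <= a * negbin k.+1 n.+1 by rewrite mulr_ge0//; lra.
have S2 : (1 - S) / s <= 2 * k.+1%:R * z.
  have h : 1 - S <= 2 * k.+1%:R / n%:R.
    apply: le_trans (@negbin_cdf_ge R k n k2n) _.
    rewrite (_ : 2 * k.+1%:R / n%:R = k.+1%:R / (n%:R / 2)); last first.
      by field; rewrite gt_eqF.
    rewrite ler_wpM2l// lef_pV2 ?posrE ?divr_gt0// ?ltr0n ?subn_gt0//.
    by rewrite natrB ?leqW// -mul2n natrM -[n.+1%:R]natr1; lra.
  rewrite (_ : 2 * k.+1%:R * z = 2 * k.+1%:R / n%:R / s); last first.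
    by rewrite /z sE; field; rewrite gt_eqF.
  by rewrite ler_pM2r ?invr_gt0.
have T1 : `|\sum_(m < n.+1) negbin k m * (first_hit (n - m) (m - k) / 4 ^+ (n - m) / central n)
   - \sum_(m < n.+1) negbin k m * (psi ((m - k)%:R / s) / s)| <= 640 * a * z.
  rewrite -sumrB; apply: le_trans (ler_norm_sum _ _ _) _.
  apply: le_trans (_ : \sum_(m < n.+1) 320 * z * (m.+1%:R * negbin k m +
    (m.+1%:R - a) ^+ 2 * negbin k m) <= _).
    apply: ler_sum => m _; rewrite -mulrBr normrM ger0_norm ?negbin_ge0//.
    rewrite (_ : 320 * z * _ = negbin k m *
      (320 * (m.+1%:R + (m.+1%:R - a) ^+ 2) * z)); last by ring.
    by rewrite ler_wpM2l ?negbin_ge0// bound// -ltnS.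
  rewrite -mulr_sumr big_split/= -/V.
  have := negbin_mean_le k n; rewrite -/a => h.
  rewrite (_ : 640 * a * z = 320 * z * (a + a)); last by ring.
  by rewrite ler_pM2l ?mulr_gt0// lerD.
pose b := psi (k%:R / s); pose d := dpsi (k%:R / s).
have b1 : `|b| <= 1 by exact: psi_le1.
have d3 : `|d| <= 3 by exact: dpsi_le3.
have T2 : `|\sum_(m < n.+1) negbin k m * (psi ((m - k)%:R / s) / s)
   - \sum_(m < n.+1) negbin k m * ((b + d * ((m.+1%:R - a + 1) / s)) / s)|
   <= 52 * (a + 1) * z.
  rewrite -sumrB; apply: le_trans (ler_norm_sum _ _ _) _.
  apply: le_trans (_ : \sum_(m < n.+1) 52 * z * (negbin k m +
    (m.+1%:R - a) ^+ 2 * negbin k m) <= _); last first.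
    rewrite -mulr_sumr big_split/= -/V -/(negbin_cdf k n) -/S.
    rewrite (_ : 52 * (a + 1) * z = 52 * z * (1 + a)); last by ring.
    by rewrite ler_pM2l ?mulr_gt0// lerD.
  apply: ler_sum => m _; rewrite -mulrBr normrM ger0_norm ?negbin_ge0//.
  rewrite (_ : 52 * z * _ = negbin k m * (52 * (1 + (m.+1%:R - a) ^+ 2) * z)); last by ring.
  (* The truncated subtraction [m - k] is genuine wherever the weight is nonzero. *)
  have [km|mk] := leqP k m; last by rewrite /negbin bin_small// !mul0r.
  rewrite ler_wpM2l ?negbin_ge0// -mulrBl normrM [X in _ * X]ger0_norm ?invr_ge0 ?(ltW s0)//.
  rewrite ler_pdivrMr//.
  have := @psi_taylor R (k%:R / s) ((m - k)%:R / s).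
  rewrite -/b -/d (_ : (m - k)%:R / s - k%:R / s = (m.+1%:R - a + 1) / s); last first.
    by rewrite natrB// aE -[m.+1%:R]natr1 -mulrBl; congr (_ / _); ring.
  rewrite opprD addrA => /le_trans; apply.
  rewrite (_ : _ * z * s = 52 * (1 + (m.+1%:R - a) ^+ 2) / s ^+ 2); last first.
    by rewrite /z; field; rewrite gt_eqF.
  rewrite expr_div_n mulrA ler_pM2r ?invr_gt0 ?exprn_gt0//.
  by have := sqr_ge0 (m.+1%:R - a - 1); lra.
have T3 : `|\sum_(m < n.+1) negbin k m * ((b + d * ((m.+1%:R - a + 1) / s)) / s)
   - b / s| <= a * z + 3 * y.
  rewrite (_ : \sum_(m < _) _ = b / s * S + d * y * (D + S)); last first.
    rewrite /S /negbin_cdf /D -big_split/= !mulr_sumr -big_split/=.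
    by apply: eq_bigr => m _; rewrite /y sE; field; rewrite gt_eqF.
  rewrite (_ : _ - _ = d * (D + S) * y - b * ((1 - S) / s)); last by ring.
  apply: le_trans (ler_normB _ _) _; rewrite addrC; apply: lerD.
    rewrite normrM -[leRHS]mul1r; apply: ler_pM => //.
    rewrite ger0_norm; first exact: S2.
    by rewrite divr_ge0 ?(ltW s0)//; lra.
  rewrite normrM (gtr0_norm y0) ler_pM2r// normrM -[leRHS]mulr1.
  by apply: ler_pM => //; rewrite DE ler_norml; lra.
set X := \sum_(m < n.+1) _ in T1 T2 *; set Y := \sum_(m < n.+1) _ in T1 T2.
set Z := \sum_(m < n.+1) _ in T2 T3.
have : `|X - b / s| <= 640 * a * z + 52 * (a + 1) * z + (a * z + 3 * y).
  rewrite (_ : X - b / s = (X - Y) + (Y - Z) + (Z - b / s)); last by ring.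
  apply: le_trans (ler_normD _ _) _; rewrite lerD//.
  by apply: le_trans (ler_normD _ _) _; rewrite lerD.
have kz0 : 0 <= k%:R * z by rewrite mulr_ge0// ltW.
(* With [a = 2 (k + 1)], twice [693 a + 52] is at most [2876 (k + 1)], below [50 * 60]. *)
rewrite -/(_ / s) -/z -/y -natr1 aE -/b; lra.
Qed.

Lemma walk_sum_falling_le n : (0 < n)%N ->
  walk_sum (fun k => k%:R * (k%:R - 1)) n 0 <= n%:R * 'C(n.*2, n)%:R :> R.
Proof.
move=> n0; have n1 : 1 <= n%:R :> R by rewrite ler1n.
have d0 : 0 < 2 * n%:R - 1 :> R by lra.
have C0 : 0 <= 'C(n.*2, n)%:R :> R by [].
rewrite -(ler_pM2r d0) walk_sum_falling.
rewrite -subr_ge0 (_ : _ - _ = n%:R * 'C(n.*2, n)%:R); last by ring.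
exact: mulr_ge0.
Qed.

Lemma flat_prob_ge0 n k : 0 <= flat_prob n k.
Proof. by rewrite divr_ge0// walk_sum_ge0. Qed.

(** Both terms are separately of order [1 / n]: the probability by Markov's inequality for the
    second factorial moment, the density by [u * expR (- u) <= 1]. *)
Lemma flat_prob_large n k : (16 <= n)%N -> (n < 8 * k)%N ->
  `|flat_prob n k - 2 * (psi (k%:R / Num.sqrt n%:R) / Num.sqrt n%:R)| <=
  128 / n%:R.
Proof.
move=> n16 nk; have n0 : 0 < n%:R :> R by rewrite ltr0n; lia.
have k3 : 3 <= k%:R :> R by rewrite ler_nat; lia.
have nk8 : n%:R <= 8 * k%:R :> R by rewrite -natrM ler_nat ltnW.
have k0 : 0 < k%:R :> R by lra.
set s := Num.sqrt n%:R.
have s0 : 0 < s by rewrite sqrtr_gt0.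
have sE : n%:R = s ^+ 2 by rewrite sqr_sqrtr// ltW.
have p0 := flat_prob_ge0 n k.
have C0 : 0 < 'C(n.*2, n)%:R :> R by rewrite ltr0n bin_gt0; lia.
have p1 : flat_prob n k <= 128 / n%:R.
  have kk : 0 < k%:R * (k%:R - 1) :> R by rewrite mulr_gt0//; lra.
  have : k%:R * (k%:R - 1) * flat_prob n k <= n%:R.
    rewrite /flat_prob mulrA ler_pdivrMr// -walk_sumZ.
    apply: le_trans (walk_sum_falling_le _); last lia.
    apply: ler_walk_sum => i; have [->|_] := eqVneq i k; first by rewrite mulr1.
    rewrite mulr0; case: i => [|i]; first by rewrite mul0r.
    by rewrite -natr1 addrK mulr_ge0// addr_ge0.
  rewrite mulrC -ler_pdivlMr// => /le_trans; apply.
  rewrite ler_pdivrMr// mulrAC ler_pdivlMr//.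
  have : n%:R * n%:R <= (8 * k%:R) * (8 * k%:R) :> R by apply: ler_pM => //; rewrite ltW.
  have : 3 * k%:R <= k%:R * k%:R :> R by rewrite ler_pM2r.
  lra.
have q0 : 0 <= psi (k%:R / s) / s.
  by rewrite divr_ge0 ?(ltW s0)// mulr_ge0 ?expR_ge0// divr_ge0 ?ltW.
have q1 : psi (k%:R / s) / s <= 8 / n%:R.
  apply: le_trans (_ : k%:R^-1 <= _); last first.
    by rewrite ler_pdivlMr// mulrC ler_pdivrMr.
  have := mul_expRN_le1 ((k%:R / s) ^+ 2); set e := expR _ => h.
  rewrite -[leRHS]mul1r ler_pdivlMr//; apply: le_trans h.
  by rewrite /psi -/e le_eqVlt; apply/orP; left; apply/eqP; field; rewrite gt_eqF.
have : 8 / n%:R <= 64 / n%:R :> R by rewrite ler_pM2r ?invr_gt0//; lra.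
by rewrite ler_norml; lra.
Qed.

Lemma flat_prob_local_limit : exists2 C : R, 0 <= C &
  forall n k, (16 <= n)%N ->
  `|flat_prob n k - 2 * (psi (k%:R / Num.sqrt n%:R) / Num.sqrt n%:R)| <=
  C * (k.+1%:R / Num.sqrt n%:R ^+ 3 + n%:R^-1).
Proof.
exists (50 * 60) => [|n k n16]; first by rewrite mulr_ge0.
have n0 : 0 < n%:R :> R by rewrite ltr0n; lia.
have [kn|nk] := leqP (8 * k)%N n; first by apply: flat_prob_small; lia.
apply: le_trans (flat_prob_large n16 nk) _.
have i0 : 0 < n%:R^-1 :> R by rewrite invr_gt0.
have : 0 <= k.+1%:R / Num.sqrt n%:R ^+ 3 :> R.
  by rewrite divr_ge0// exprn_ge0// sqrtr_ge0.
lra.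
Qed.
End LocalLimit.

(** * Moments and limit distribution *)

Section UniformGrandDyck.
Context {R : realType}.
Implicit Types (n k : nat).

Lemma card_grand_dyck n : #|{: grand_dyck n}|%:R = 'C(n.*2, n)%:R :> R.
Proof.
rewrite -sum1_card natr_sum.
by rewrite (sum_degree_of_symmetry (fun=> 1)) walk_sum1 addn0.
Qed.

Lemma gd_uniform_pred n (q : pred nat) :
  gd_uniform R n [set P | q (degree_of_symmetry P)] =
  (walk_sum (fun k => (q k)%:R) n 0 / 'C(n.*2, n)%:R)%:E.
Proof.
pose A := [set P : grand_dyck n | q (degree_of_symmetry P)]%SET.
rewrite (_ : [set P | _] = [set` A]); last first.
  by apply/seteqP; split=> P /=; rewrite inE.
rewrite gd_uniformE card_grand_dyck -sum1_card natr_sum -sum_degree_of_symmetry.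
rewrite big_mkcond; congr ((_ / _)%:E); apply: eq_bigr => P _.
by rewrite inE; case: (q _).
Qed.

Lemma ge0_integral_gd_uniform n (f : grand_dyck n -> R) : (forall P, 0 <= f P) ->
  (\int[gd_uniform R n]_P (f P)%:E = ((\sum_P f P) / 'C(n.*2, n)%:R)%:E)%E.
Proof.
move=> f0.
transitivity (\int[gd_uniform R n]_P
    (\sum_(Q <- enum {: grand_dyck n}) (f Q * \1_[set Q] P)%:E))%E.
  apply: eq_integral => P _; rewrite sumEFin big_enum/= (bigD1 P)//= indicE.
  rewrite mem_set// mulr1 big1 ?addr0// => Q QP.
  by rewrite indicE memNset ?mulr0// => /= PQ; rewrite PQ eqxx in QP.
rewrite ge0_integral_sum//; last first.
  by move=> Q P _; rewrite lee_fin mulr_ge0// indicE.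
rewrite mulr_suml -sumEFin big_enum/=; apply: eq_bigr => Q _.
under eq_integral do rewrite EFinM.
rewrite ge0_integralZl_EFin//.
rewrite integral_indic// setIT.
have eQ : gd_uniform R n [set Q] = ('C(n.*2, n)%:R^-1)%:E.
  rewrite (_ : [set Q] = [set` [set Q]%SET]); last first.
    by apply/seteqP; split=> P /=; rewrite inE => /eqP.
  by rewrite gd_uniformE cards1 card_grand_dyck mul1r.
by rewrite EFinM; congr (_ * _)%E.
Qed.

Lemma pmf_sym_rv n k :
  pmf (P := gd_uniform R n) (sym_rv R n) k%:R = flat_prob n k.
Proof.
rewrite /pmf /flat_prob (_ : _ @^-1` _ =
    [set P | (fun i => i == k) (degree_of_symmetry P)]); last first.
  apply/seteqP; split=> P /=; rewrite /sym_rv.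
    by move/eqP; rewrite eqr_nat.
  by move/eqP => ->.
exact: (congr1 fine (gd_uniform_pred n (fun i => i == k))).
Qed.

Lemma expectation_sym_rv n : fine 'E_(gd_uniform R n)[sym_rv R n] =
  walk_sum (fun k => k%:R) n 0 / 'C(n.*2, n)%:R.
Proof.
by rewrite unlock ge0_integral_gd_uniform//= -sum_degree_of_symmetry.
Qed.

Lemma variance_sym_rv n (e := fine 'E_(gd_uniform R n)[sym_rv R n] : R) :
  fine 'V_(gd_uniform R n)[sym_rv R n] =
  walk_sum (fun k => k%:R * (k%:R - 1)) n 0 / 'C(n.*2, n)%:R + e - e ^+ 2.
Proof.
rewrite /variance unlock -/e unlock ge0_integral_gd_uniform//= => [|P]; last first.
  by rewrite !fctE /= -expr2 sqr_ge0.
(* This is [(k - e) ^+ 2] in the basis of falling factorials, whose moments are known exactly. *)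
pose phi (k : nat) : R := k%:R * (k%:R - 1) + (1 - 2 * e) * k%:R + e ^+ 2 * 1.
rewrite (eq_bigr (fun P : grand_dyck n => phi (degree_of_symmetry P))); last first.
  by move=> P _; rewrite !fctE /phi /sym_rv /=; ring.
rewrite sum_degree_of_symmetry !walk_sumD !walk_sumZ walk_sum1 addn0.
have C0 : 'C(n.*2, n)%:R != 0 :> R by rewrite pnatr_eq0 -lt0n bin_gt0; lia.
have := expectation_sym_rv n; rewrite -/e => eE.
rewrite mulrDl mulrDl -[_ * walk_sum _ _ _ / _]mulrA -eE mulrK ?unitfE//; ring.
Qed.

Lemma expectation_sym_rvE n : (0 < n)%N ->
  fine 'E_(gd_uniform R n)[sym_rv R n] = (2 * central n)^-1.
Proof.
case: n => // n _; rewrite expectation_sym_rv walk_sum_id /central exprS.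
by field; rewrite pnatr_eq0 -lt0n bin_gt0 expf_neq0//; lia.
Qed.

Lemma inv_central_close n : (0 < n)%N ->
  [/\ pi * n%:R <= (central n)^-1 ^+ 2 :> R,
      (central n)^-1 ^+ 2 <= pi * n%:R + 2 :> R, 0 < (central n)^-1 :> R
    & `|(central n)^-1 - Num.sqrt (pi * n%:R)| <= 2 :> R].
Proof.
move=> n0; have b0 := @central_gt0 R n; have p0 := pi_gt0 R.
have n1 : 1 <= n%:R :> R by rewrite ler1n.
have p2 : 2 <= pi :> R by exact: pi_ge2.
have x0 : 0 < (central n)^-1 :> R by rewrite invr_gt0.
set x := (central n)^-1 in x0 *.
have bx : central n * x = 1 by rewrite /x divff// gt_eqF.
have x2 : 0 < x ^+ 2 by rewrite exprn_gt0.
have bx2 : central n ^+ 2 * x ^+ 2 = 1 by rewrite -exprMn bx expr1n.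
have h1 : pi * n%:R <= x ^+ 2.
  have := ler_wpM2r (ltW x2) (@central_sqr_le R n); rewrite mul1r; apply: le_trans.
  by rewrite -[leRHS]mulrA bx2 mulr1.
have h2 : x ^+ 2 <= pi * n%:R + 2.
  have := ler_wpM2r (ltW x2) (@central_sqr_ge R n); rewrite mul1r => /le_trans; apply.
  by rewrite -[leLHS]mulrA bx2 mulr1; have := @pi_le4 R; lra.
split=> //; set y := Num.sqrt _; have y1 : 1 <= y.
  rewrite -sqrtr1 ler_sqrt; last by rewrite mulr_ge0 ?(ltW p0).
  by have := ler_wpM2r (ltW p0) n1; lra.
have yE : y ^+ 2 = pi * n%:R by rewrite sqr_sqrtr// mulr_ge0// ltW.
rewrite -yE in h1 h2.
have xy : y <= x by rewrite -(@ler_pXn2r _ 2) ?nnegrE ?(ltW x0)//; lra.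
rewrite ger0_norm ?subr_ge0//.
have : (x - y) * (x + y) <= 2 by lra.
by apply: le_trans; rewrite ler_peMr ?subr_ge0//; lra.
Qed.

Lemma expectation_sym_rv_close n : (0 < n)%N ->
  `|fine 'E_(gd_uniform R n)[sym_rv R n] - Num.sqrt (pi * n%:R) / 2| <= 1.
Proof.
move=> n0; rewrite expectation_sym_rvE// invfM.
have [_ _ _] := inv_central_close n0.
set x := (central n)^-1; set y := Num.sqrt _.
by rewrite !ler_norml; lra.
Qed.

(** The second factorial moment is [n + O(1)] and the squared mean is [pi n / 4 + O(1)]; the error
    of order [sqrt n] is the mean itself. *)
Lemma variance_sym_rv_close n : (0 < n)%N ->
  `|fine 'V_(gd_uniform R n)[sym_rv R n] - (1 - pi / 4) * n%:R|
    <= 5 * Num.sqrt n%:R.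
Proof.
move=> n0; rewrite variance_sym_rv expectation_sym_rvE// invfM.
have [h1 h2 x0] := inv_central_close n0.
set x := (central n)^-1 in h1 h2 x0 *.
have n1 : 1 <= n%:R :> R by rewrite ler1n.
have C0 : 'C(n.*2, n)%:R != 0 :> R by rewrite pnatr_eq0 -lt0n bin_gt0; lia.
set s := Num.sqrt n%:R.
have s1 : 1 <= s by rewrite -sqrtr1 ler_sqrt//; lra.
have sE : s ^+ 2 = n%:R by rewrite sqr_sqrtr//; lra.
have ss : Num.sqrt (pi * n%:R) <= 2 * s :> R.
  rewrite sqrtrM ?pi_ge0// ler_wpM2r ?sqrtr_ge0//.
  have -> : 2 = Num.sqrt (2 ^+ 2) :> R by rewrite sqrtr_sqr ger0_norm.
  by rewrite ler_wsqrtr//; have := @pi_le4 R; lra.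
set w := walk_sum _ _ _ / _.
have wE : w * (2 * n%:R - 1) = 2 * n%:R * (n%:R - 1).
  by rewrite /w mulrAC walk_sum_falling mulfK.
have wn : n%:R - 1 <= w <= n%:R.
  have d0 : 0 < 2 * n%:R - 1 :> R by lra.
  by rewrite -(ler_pM2r d0) -[w <= _](ler_pM2r d0) wE; apply/andP; split; nra.
by move=> xy; move: xy wn; rewrite !ler_norml exprMn; lra.
Qed.
End UniformGrandDyck.

(** * The Rayleigh distribution function *)

Section RayleighCdf.
Context {R : realType}.
Implicit Types (n k K : nat) (x : R).

Lemma rayleigh_pdf_halfE x : 0 <= x ->
  rayleigh_pdf (Num.sqrt 2)^-1 x = 2 * x * expR (- x ^+ 2).
Proof.
move=> x0; rewrite rayleigh_pdfE// exprVn sqr_sqrtr// invrK mulrV ?unitfE//.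
by rewrite divr1 [x * 2]mulrC.
Qed.

Lemma rayleigh_prob_lt0 x : x < 0 ->
  rayleigh_prob ((Num.sqrt (2 : R))^-1)%:pos `]-oo, x] = 0%E.
Proof.
move=> x0; rewrite /rayleigh_prob; apply: integral0_eq => y /=.
rewrite in_itv/= => yx; rewrite /rayleigh_pdf patchE ifF//.
apply: memNset => /=; rewrite in_itv/= andbT; apply/negP; rewrite -ltNge.
exact: le_lt_trans x0.
Qed.

(** Computed on the complement []x, +oo[], where the density has a single continuous formula and the
    primitive [- expR (- y ^+ 2)] tends to 0. *)
Lemma rayleigh_prob_ge0 x : 0 <= x ->
  rayleigh_prob ((Num.sqrt (2 : R))^-1)%:pos `]-oo, x] =
  (1 - expR (- x ^+ 2))%:E.
Proof.
move=> x0; set sigma := (_%:pos : {posnum R}).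
suff e : rayleigh_prob sigma `]x, +oo[ = (expR (- x ^+ 2))%:E.
  rewrite -setCitvr probability_setC//.
  by rewrite [X in (_ - X)%E]e EFinB.
rewrite /rayleigh_prob integral_itv_obnd_cbnd; last first.
  apply/measurable_funTS/measurableT_comp => //.
  exact: measurable_rayleigh_pdf.
transitivity (\int[lebesgue_measure]_(y in `[x, +oo[) (2 * psi y)%:E)%E.
  apply: eq_integral => y; rewrite inE/= in_itv/= andbT => xy.
  by rewrite rayleigh_pdf_halfE ?mulrA//; exact: le_trans xy.
have cpsi : continuous (fun y : R => 2 * psi y).
  move=> y; apply: cvgM; first exact: cvg_cst.
  have [d _] := is_derive_psi y.
  exact/differentiable_continuous/derivable1_diffP.
have cF : continuous (fun y : R => - expR (- y ^+ 2)).
  move=> y; have [d _] := is_derive_gauss_tail y.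
  exact/differentiable_continuous/derivable1_diffP.
rewrite (@ge0_continuous_FTC2y _ _ (fun y => - expR (- y ^+ 2)) x 0).
- by rewrite -EFinB sub0r opprK.
- move=> y xy; rewrite mulr_ge0// mulr_ge0 ?expR_ge0//; exact: le_trans xy.
- exact: continuous_subspaceT.
- rewrite -oppr0; apply: cvgN.
  apply: (@cvg_comp _ _ _ (fun y : R => y ^+ 2) (fun y : R => expR (- y)) _ (pinfty_nbhs R)).
    exact: cvgr_expr2.
  exact: cvgr_expR.
- by move=> y _; have [] := is_derive_gauss_tail y.
- by apply/cvg_at_right_filter; exact: cF.
- by move=> y _; rewrite derive1E; have [] := is_derive_gauss_tail y.
Qed.
End RayleighCdf.

(** * Convergence of the distribution functions *)

Section CdfLimit.
Context {R : realType}.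
Implicit Types (n k K : nat) (x : R).

Lemma distribution_sym_rv n x :
  distribution (gd_uniform R n) ((Num.sqrt n%:R)^-1 \o* sym_rv R n) `]-oo, x] =
  (walk_sum (fun k => (k%:R / Num.sqrt n%:R <= x)%R%:R) n 0 / 'C(n.*2, n)%:R)%:E.
Proof.
rewrite -(gd_uniform_pred n (fun k : nat => k%:R / Num.sqrt n%:R <= x)).
by rewrite /distribution /pushforward; congr (gd_uniform _ _ _); apply/seteqP;
  split=> P /=; rewrite in_itv.
Qed.

Lemma walk_sum_leq n K : walk_sum (fun k => (k <= K)%N%:R) n 0 / 'C(n.*2, n)%:R =
  \sum_(k < K.+1) flat_prob n k :> R.
Proof.
rewrite /flat_prob -mulr_suml; congr (_ / _).
elim: K => [|K IH].
  by rewrite big_ord1; apply: eq_walk_sum => k; rewrite leqn0.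
rewrite big_ord_recr /= -IH -walk_sumD; apply: eq_walk_sum => k.
by rewrite leq_eqVlt ltnS addrC; case: eqVneq => [->|_]; rewrite ?ltnn ?addr0 ?add0r.
Qed.

(** About [x * s] local estimates, each with an error of order [1 / s ^+ 2], add up to an error of
    order [1 / s]. *)
Lemma flat_prob_cdf_close x : 0 <= x -> exists2 C : R, 0 <= C &
  forall n, (16 <= n)%N ->
  `|walk_sum (fun k => (k%:R / Num.sqrt n%:R <= x)%R%:R) n 0 / 'C(n.*2, n)%:R
    - (1 - expR (- x ^+ 2))| <= C / Num.sqrt n%:R.
Proof.
move=> x0; have [C C0 local] := @flat_prob_local_limit R.
exists ((C + 6) * (x + 2) ^+ 2 + 2) => [|n n16].
  by rewrite addr_ge0// mulr_ge0 ?sqr_ge0// addr_ge0.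
have n0 : 0 < n%:R :> R by rewrite ltr0n; lia.
set s := Num.sqrt n%:R.
have s0 : 0 < s by rewrite sqrtr_gt0.
have sE : s ^+ 2 = n%:R by rewrite sqr_sqrtr// ltW.
have s1 : 1 <= s by rewrite -sqrtr1 ler_sqrt// ler1n; lia.
have xs0 : 0 <= x * s by rewrite mulr_ge0// ltW.
pose K := Num.truncn (x * s).
have /andP[Kl Ku] := truncn_itv xs0; rewrite -/K in Kl Ku.
rewrite (eq_walk_sum _ _ (_ : _ =1 (fun k => (k <= K)%N%:R))); last first.
  by move=> k; rewrite ler_pdivrMr// truncn_ge_nat.
rewrite walk_sum_leq.
(* [1 - A k] is the limiting distribution function at [k / s]; its increments approximate the
   probabilities and telescope. *)
pose A k := expR (- (k%:R / s) ^+ 2) : R.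
have tel : \sum_(k < K.+1) (A k - A k.+1) = 1 - A K.+1.
  rewrite -(big_mkord xpredT (fun k => A k - A k.+1)).
  rewrite (@telescope_sumr_eq _ _ _ (fun k => - A k))//.
    by rewrite opprK addrC /A mul0r expr0n oppr0 expR0.
  by move=> k _; rewrite opprK addrC.
have Kx : K.+1%:R <= (x + 1) * s.
  by rewrite mulrDl mul1r -natr1 lerD.
have close k : (k < K.+1)%N ->
    `|flat_prob n k - (A k - A k.+1)| <= (C + 6) * (x + 2) / s ^+ 2.
  move=> kK; have kx : k.+1%:R <= (x + 1) * s by apply: le_trans Kx; rewrite ler_nat.
  have := local n k n16; rewrite -/s => h1.
  have := @gauss_tail_taylor R (k%:R / s) (k.+1%:R / s).
  rewrite -/(A k) -/(A k.+1).
  rewrite (_ : k.+1%:R / s - k%:R / s = s^-1); last first.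
    by rewrite -mulrBl -natr1 addrAC subrr add0r mul1r.
  rewrite -[2 * _ * _]mulrA exprVn => h2.
  have h3 : k.+1%:R / s ^+ 3 <= (x + 1) / s ^+ 2.
    rewrite ler_pdivrMr ?exprn_gt0// (_ : _ * s ^+ 3 = (x + 1) * s)//.
    by field; rewrite gt_eqF.
  rewrite (_ : _ - _ = (flat_prob n k - 2 * (psi (k%:R / s) / s)) -
    (A k - A k.+1 - 2 * (psi (k%:R / s) / s))); last by ring.
  apply: le_trans (ler_normB _ _) _; apply: le_trans (lerD h1 h2) _.
  rewrite -sE.
  have : 0 < (s ^+ 2)^-1 by rewrite invr_gt0 exprn_gt0.
  move: (s ^+ 2)^-1 (k.+1%:R / s ^+ 3) h3 => z y h3 z0.
  have := ler_wpM2l C0 h3; have : 0 <= x * z by rewrite mulr_ge0// ltW.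
  lra.
(* The grid point [K.+1 / s] lies within [1 / s] of [x], and the density is at most 2. *)
have lip : `|A K.+1 - expR (- x ^+ 2)| <= 2 / s.
  have d2 y : `|2 * psi y| <= 2 :> R.
    by rewrite normrM ger0_norm// -[leRHS]mulr1 ler_wpM2l// psi_le1.
  have := lipschitz_is_derive (K.+1%:R / s) x (@is_derive_gauss_tail R) d2.
  rewrite opprK addrC => /le_trans; apply; rewrite ler_pM2l// ler_norml.
  have xE : x = x * s / s by rewrite mulfK// gt_eqF.
  have si0 : 0 < s^-1 by rewrite invr_gt0.
  have := ler_wpM2r (ltW si0) Kl; have := ler_wpM2r (ltW si0) (ltW Ku).
  by rewrite -xE -natr1 mulrDl mul1r; lra.
rewrite (_ : _ - _ = \sum_(k < K.+1) (flat_prob n k - (A k - A k.+1)) -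
    (A K.+1 - expR (- x ^+ 2))); last by rewrite sumrB tel; ring.
apply: le_trans (ler_normB _ _) _.
rewrite mulrDl.
apply: lerD lip; apply: le_trans (ler_norm_sum _ _ _) _.
apply: le_trans (ler_sum _ (fun (k : 'I_K.+1) _ => close k (ltn_ord k))) _.
rewrite sumr_const card_ord -[_ *+ K.+1]mulr_natr.
rewrite (_ : (C + 6) * (x + 2) ^+ 2 / s =
  (C + 6) * (x + 2) / s ^+ 2 * ((x + 2) * s)); last first.
  by field; rewrite gt_eqF.
rewrite ler_wpM2l//; last by apply: le_trans Kx _; rewrite ler_pM2r//; lra.
by rewrite divr_ge0 ?sqr_ge0// mulr_ge0//; lra.
Qed.
End CdfLimit.

Lemma cvg_inv_sqrt_rate (R : realType) (u : nat -> R) (l C : R) (N : nat) :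
  (forall n, (N <= n)%N -> `|u n - l| <= C / Num.sqrt n%:R) ->
  u n @[n --> \oo] --> l.
Proof.
move=> ul; apply/cvgrPdist_le => e e0.
exists (maxn N.+1 (Num.truncn ((C / e) ^+ 2)).+1) => // n /=.
rewrite geq_max => /andP[Nn Cn]; rewrite distrC; apply: le_trans (ul _ (ltnW Nn)) _.
have n0 : 0 < n%:R :> R by rewrite ltr0n; lia.
rewrite ler_pdivrMr ?sqrtr_gt0// mulrC -ler_pdivrMr//.
apply: le_trans (ler_norm _) _; rewrite -sqrtr_sqr ler_wsqrtr//.
have /andP[_ /ltW/le_trans] := truncn_itv (sqr_ge0 (C / e)); apply.
by rewrite ler_nat.
Qed.

Lemma powR_neg32 (R : realType) (x : R) : 0 <= x ->
  x `^ (- 3 / 2) = (Num.sqrt x ^+ 3)^-1.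
Proof.
move=> x0; rewrite (_ : - 3 / 2 = 2^-1 * - 3%:R); last by field.
by rewrite powRrM powR12_sqrt// powRN powR_mulrn// sqrtr_ge0.
Qed.

Theorem proposition3p4 (R : realType) :
  [/\ cvg_in_distribution
        (fun n => distribution (gd_uniform R n)
                    ((Num.sqrt n%:R)^-1 \o* sym_rv R n))
        (rayleigh_prob ((Num.sqrt (2 : R))^-1)%:pos),
      forall x : R, 0 <= x ->
        rayleigh_pdf (Num.sqrt 2)^-1 x = 2 * x * expR (- x ^+ 2),
      (fun n => fine 'E_(gd_uniform R n)[sym_rv R n])
        = (fun n => Num.sqrt (pi * n%:R) / 2) +O_\oo (fun=> 1 : R),
      (fun n => fine 'V_(gd_uniform R n)[sym_rv R n])
        = (fun n => (1 - pi / 4) * n%:R) +O_\oo (fun n => Num.sqrt n%:R : R)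
    & exists C : R, \forall n \near \oo, forall k : nat,
        `|pmf (P := gd_uniform R n) (sym_rv R n) k%:R
          - 2 * k%:R / n%:R * expR (- k%:R ^+ 2 / n%:R)|
        <= C * (k.+1%:R * n%:R `^ (- 3 / 2) + n%:R^-1)].
Proof.
split.
- move=> x _; pose u n : R :=
    walk_sum (fun k => (k%:R / Num.sqrt n%:R <= x)%R%:R) n 0 / 'C(n.*2, n)%:R.
  suff [l el ul] : exists2 l : R,
      rayleigh_prob ((Num.sqrt (2 : R))^-1)%:pos `]-oo, x] = l%:E &
      u n @[n --> \oo] --> l.
    have eu : (fun n => distribution (gd_uniform R n)
        ((Num.sqrt n%:R)^-1 \o* sym_rv R n) `]-oo, x]) = EFin \o u.
      by apply/funext => n; exact: distribution_sym_rv.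
    have : (EFin \o u) n @[n --> \oo] --> l%:E.
      by apply: cvg_EFin => //; apply: nearW.
    by rewrite -eu -el.
  have [x0|x0] := ltP x 0.
    exists 0; first exact: rayleigh_prob_lt0.
    rewrite (_ : u = fun=> 0); first exact: cvg_cst.
    apply/funext => n; rewrite /u (eq_walk_sum (psi := fun=> 0 * 0)).
      by rewrite walk_sumZ mul0r mul0r.
    move=> k; have k0 : 0 <= k%:R / Num.sqrt n%:R :> R by rewrite divr_ge0// sqrtr_ge0.
    by rewrite mul0r (lt_geF (lt_le_trans x0 k0)).
  exists (1 - expR (- x ^+ 2)); first exact: rayleigh_prob_ge0.
  have [C _ close] := flat_prob_cdf_close x0.
  exact: cvg_inv_sqrt_rate close.
- exact: rayleigh_pdf_halfE.
- apply/eqaddOP/bigO_exP; exists 1 => //; exists 1%N => // n /= n0.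
  by rewrite normr1 mulr1; exact: expectation_sym_rv_close.
- apply/eqaddOP/bigO_exP; exists 5 => //; exists 1%N => // n /= n0.
  by rewrite (ger0_norm (sqrtr_ge0 _)); exact: variance_sym_rv_close.
- have [C C0 local] := @flat_prob_local_limit R.
  exists C; exists 16%N => // n /= n16 k.
  have n0 : 0 < n%:R :> R by rewrite ltr0n; lia.
  have := local n k n16; rewrite pmf_sym_rv powR_neg32 ?ler0n//.
  congr (`|_ - _| <= _).
  rewrite /psi expr_div_n sqr_sqrtr ?ler0n// mulNr mulrA mulrAC.
  have s0 : Num.sqrt n%:R != 0 :> R by rewrite gt_eqF// sqrtr_gt0.
  by rewrite -[X in _ = _ / X * _](sqr_sqrtr (ltW n0)); field.
Qed.
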